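(* Let $K$ be an algebraically closed field of characteristic $0$, $n\in\mathbb{N}$, let $\widetilde Z\subseteq\mathbb{P}^n_K$ be a projective (closed sub)scheme, let $p\in\mathbb{P}^n_K\setminus\widetilde Z$ be a closed point, and let $\pi:\widetilde Z\twoheadrightarrow Z\subseteq\mathbb{P}^{n-1}_K$ be the outer simple linear projection from $p$. Let $x\in R_1\setminus\mathfrak{p}_1$ be a linear form not vanishing at $p$, and let $k\in\mathbb{N}$. Then the sets $D_f$, for $f\in(I_{\widetilde Z})^\circ_{x,k}$, form an affine covering of $Z_k^\circ$ (i.e. they are affine open subsets of $Z_k^\circ$ whose union is $Z_k^\circ$). Moreover, for all $f\in(I_{\widetilde Z})^\circ_{x,k}$, all $q\in D_f$ and all partitions $\lambda$ of $k$, $$q\in Z_\lambda^\circ\iff f\!\upharpoonright_q\,\in X_\lambda^\circ .$$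
   Context: Notation. $\mathbb{N}$ denotes the positive integers. $R=K[x_0,\dots,x_n]$ is the homogeneous coordinate ring of $\mathbb{P}^n_K$, $\mathfrak{p}\subset R$ is the homogeneous ideal of $p$, $\mathfrak{p}_1$ its space of linear forms, and $S:=K[\mathfrak{p}_1]\subset R$ the $K$-subalgebra generated by $\mathfrak{p}_1$. The simple linear projection $\mathbb{P}^n_K\setminus\{p\}\to\mathbb{P}^{n-1}_K=\mathrm{Proj}(S)$ is given by the inclusion $S\hookrightarrow R$; $\pi$ is its restriction to $\widetilde Z$ and $Z$ is the image of $\widetilde Z$. $I_{\widetilde Z}\subseteq R$ is the saturated homogeneous ideal with $\widetilde Z=\mathrm{Proj}(R/I_{\widetilde Z})$. Fibers. For a closed point $q\in Z$ let $\mathfrak{q}\subset S$ be its homogeneous ideal. The projective line $\langle q,p\rangle=\mathbb{P}^1_K$ spanned by $q$ and $p$ is $\mathrm{Proj}(R/\mathfrak{q}R)$. The fiber $\pi^{-1}(q)=\widetilde Z\cap\langle q,p\rangle$ is a closed subscheme of finite length of $\langle q,p\rangle$, hence an effective divisor on $\mathbb{P}^1_K$; its length is the degree of this divisor. For $k\in\mathbb{N}$, $Z_k^\circ$ is the set of closed points $q\in Z$ such that $\pi^{-1}(q)$ has length exactly $k$ (a locally closed set). Partitions. A partition of $k$ is a family $\lambda=(\lambda_1,\dots,\lambda_e)$ of positive integers with $\lambda_1+\dots+\lambda_e=k$. $Z_\lambda^\circ$ is the set of closed points $q\in Z$ such that $\pi^{-1}(q)=\sum_{i=1}^e\lambda_i\widetilde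 q_i$ as divisors, with distinct closed points $\widetilde q_1,\dots,\widetilde q_e\in\langle q,p\rangle$. Polynomials in $x$. Since $x\in R_1\setminus\mathfrak{p}_1$, $R=S[x]$; for $f\in R$, $\deg_x(f)$ and $\mathrm{LC}_x(f)\in S$ are its degree and leading coefficient as a polynomial in $x$ over $S$. $(I_{\widetilde Z})^\circ_{x,k}$ is the set of (homogeneous) $f\in I_{\widetilde Z}$ with $\deg_x(f)=k$. For such $f$, $D_f:=Z_k^\circ\setminus V(\mathrm{LC}_x(f))$ is the set of points of $Z_k^\circ$ at which $\mathrm{LC}_x(f)$ does not vanish. Restriction. For a closed point $q\in Z$ fix a linear form $y\in S_1\setminus\mathfrak{q}$; then $S/\mathfrak{q}=K[y]$ and $R/\mathfrak{q}R=K[x,y]$. $f\!\upharpoonright_q$ denotes the class of $f$ in $R/\mathfrak{q}R=K[x,y]$. If $f=\sum_{i=0}^kf_ix^{k-i}$ with $f_i\in S$ is homogeneous of total degree $t$, then $f_i+\mathfrak{q}=\bar f_i\,y^{t-k+i}$ with $\bar f_i\in K$, and $f\!\upharpoonright_q$ is regarded as the binary form $\sum_{i=0}^k\bar f_ix^{k-i}y^i$ of degree $k$, i.e. as the point $(\bar f_0:\dots:\bar f_k)\in\mathbb{P}^k_K$. Coincident root loci. A point $(a_0:\dots:a_k)\in\mathbb{P}^k_K$ is identified with the binary form $\sum_{j=0}^ka_jx^{k-j}y^j$ up to a nonzero scalar. For a partition $\lambda=(\lambda_1,\dots,\lambda_e)$ of $k$, $X_\lambda\subseteq\mathbb{P}^k_K$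 is the projective variety of binary forms that can be written as $\prod_{i=1}^eL_i^{\lambda_i}$ with linear forms $L_1,\dots,L_e\in K[x,y]_1$ (not necessarily distinct), and $X_\lambda^\circ\subseteq X_\lambda$ is the open subset of those for which $L_1,\dots,L_e$ can be chosen pairwise non-proportional.
   Formalization: D_f is claimed affine only if deg f > k or Z_k° is finite: otherwise D_f = Z_k° is infinite and closed in P^{n-1}, so not affine (e.g. f = x²−yz, k = 2, D_f = P¹). The D_f with deg f > k are shown to cover Z_k°. *)

(* Defs.v *)
From mathcomp Require Import all_boot all_order all_algebra.
From mathcomp Require Export mpoly.

Set Implicit Arguments.
Unset Strict Implicit.
Unset Printing Implicit Defensive.

Import GRing.Theory.
Local Open Scope ring_scope.

(* Ideals, subalgebras and points are Prop-valued predicates on polynomials. *)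
Notation pset K N := ({mpoly K[N]} -> Prop).

Section Ideals.
Context {K : closedFieldType} {N : nat}.
Implicit Types (J T : pset K N) (g : {mpoly K[N]}).

(* The unit ideal is allowed: it is the saturated ideal of the empty scheme. *)
Definition is_ideal J : Prop :=
  [/\ J 0, forall g h, J g -> J h -> J (g + h) & forall g h, J h -> J (g * h)].

Definition homogeneous_ideal J : Prop :=
  is_ideal J /\ forall g d, J g -> J (pihomog mdeg d g).

Definition saturation J : pset K N := fun g =>
  exists s : nat, forall m : 'X_{1..N}, mdeg m = s -> J ('X_[m] * g).

Definition saturated J : Prop := forall g, saturation J g -> J g.

Definition ideal_generated T : pset K N := fun g =>
  exists (s : nat) (c t : 'I_s -> {mpoly K[N]}),
    (forall i, T (t i)) /\ g = \sum_(i < s) c i * t i.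

Definition subalgebra_generated T : pset K N := fun g =>
  exists (s : nat) (l : s.-tuple {mpoly K[N]}) (h : {mpoly K[s]}),
    (forall i, T (tnth l i)) /\ g = comp_mpoly l h.

(* The homogeneous ideal of the point (a_1 : ... : a_N): the field being
   infinite, it consists of the polynomials vanishing on the whole line Ka. *)
Definition point_ideal (a : 'rV[K]_N) : pset K N :=
  fun g => forall s : K, g.@[(s *: a) 0] = 0.

(* Closed points of projective space, identified with their homogeneous
   ideals; as K is algebraically closed they all have coordinates in K. *)
Definition closed_point (P : pset K N) : Prop :=
  exists2 a : 'rV[K]_N, a != 0 & P = point_ideal a.

End Ideals.

(* Zariski topology and regular functions, uniformly for affine and projective
   varieties. A point is given by the ideal P of the functions vanishing at it,
   and [A d g] says that g is an admissible numerator or denominator of weight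
   d. The value of g/h at P (for h not in P) is the scalar c such that
   g - c h lies in P. *)
Definition weighted K N := nat -> pset K N.

Section Varieties.
Context {K : closedFieldType}.

Definition zopen N (A : weighted K N) (W U : pset K N -> Prop) : Prop :=
  exists T : pset K N, (forall g, T g -> exists d, A d g) /\
    forall P, U P <-> W P /\ ~ (forall g, T g -> P g).

Definition regular N (A : weighted K N) (U : pset K N -> Prop)
    (phi : pset K N -> K) : Prop :=
  forall P, U P -> exists d g h,
    [/\ A d g, A d h, ~ P h &
        forall P', U P' -> ~ P' h -> P' (g - phi P' *: h)].

Definition isomorphic N (A : weighted K N) (W : pset K N -> Prop)
    N' (A' : weighted K N') (W' : pset K N' -> Prop) : Prop :=
  exists Phi : pset K N -> pset K N',
    let pre (U' : pset K N' -> Prop) := fun P => W P /\ U' (Phi P) in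
    [/\ forall P, W P -> W' (Phi P),
        forall P Q, W P -> W Q -> Phi P = Phi Q -> P = Q,
        forall P', W' P' -> exists2 P, W P & Phi P = P',
        forall U' : pset K N' -> Prop, (forall P', U' P' -> W' P') ->
          (zopen A' W' U' <-> zopen A W (pre U'))
      & forall (U' : pset K N' -> Prop) (phi : pset K N' -> K),
          zopen A' W' U' ->
          (regular A' U' phi <-> regular A (pre U') (fun P => phi (Phi P)))].

Definition affine_weight N : weighted K N := fun _ _ => True.

Definition affine_closed N (T : pset K N) : pset K N -> Prop := fun P =>
  exists2 a : 'rV[K]_N, (forall g, T g -> g.@[a 0] = 0)
                      & P = (fun g => g.@[a 0] = 0).

Definition affine N (A : weighted K N) (W : pset K N -> Prop) : Prop :=
  exists (N' : nat) (T : pset K N'),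
    isomorphic A W (@affine_weight N') (affine_closed T).

Definition finite_pts N (W : pset K N -> Prop) : Prop :=
  exists (s : nat) (P : 'I_s -> pset K N), forall Q, W Q -> exists i, Q = P i.

End Varieties.

Definition partition_of (k e : nat) (lam : 'I_e -> nat) : Prop :=
  (forall i, (0 < lam i)%N) /\ (\sum_i lam i)%N = k.

Section Projection.
Context {K : closedFieldType} {n : nat}.
Local Notation R := {mpoly K[n.+1]}.
Implicit Types (I q : pset K n.+1) (p : 'rV[K]_n.+1) (x f y : R).

Definition forms1 p : pset K n.+1 := fun l => l \is 1.-homog /\ point_ideal p l.

Definition projS p : pset K n.+1 := subalgebra_generated (forms1 p).

Definition weightS p : weighted K n.+1 := fun d g => projS p g /\ g \is d.-homog.

(* Closed points of Proj(R/I). *)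
Definition scheme_pt I (P : pset K n.+1) : Prop :=
  closed_point P /\ forall g, I g -> P g.

(* Closed points of the image Z; a closed point q of Proj(S) is given by its
   homogeneous ideal in S, and the projection is P |-> P \cap S. *)
Definition imageZ I p (q : pset K n.+1) : Prop :=
  exists2 P, scheme_pt I P & q = (fun g => projS p g /\ P g).

(* The fiber over q, with ideal I + qR, is the divisor \sum_i m_i b_i on the
   line Proj(R/qR). The closed subscheme of that line given by this divisor has
   ideal qR + (\prod_i L_i^(m_i)), with L_i a linear form that does not vanish
   identically on the line and vanishes at b_i. Two homogeneous ideals define
   the same subscheme iff they have the same saturation. *)
Definition fiber_is_divisor I q e (m : 'I_e -> nat) (b : 'I_e -> pset K n.+1)
    : Prop :=
  [/\ forall i, closed_point (b i) /\ (forall g, q g -> b i g),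
      injective b
    & exists L : 'I_e -> R,
      [/\ forall i, L i \is 1.-homog,
          forall i, b i (L i) /\ ~ ideal_generated q (L i)
        & forall g,
            saturation (ideal_generated (fun h => I h \/ q h)) g <->
            saturation (ideal_generated
              (fun h => h = \prod_i L i ^+ m i \/ q h)) g]].

Definition Zk I p (k : nat) q : Prop :=
  imageZ I p q /\
  exists e (m : 'I_e -> nat) b, fiber_is_divisor I q m b /\ (\sum_i m i)%N = k.

Definition Zlam I p e (lam : 'I_e -> nat) q : Prop :=
  imageZ I p q /\ exists b, fiber_is_divisor I q lam b.

(* f = \sum_(i <= k) c_i x^(k-i) with c_i in S. The c_i are unique as R = S[x],
   so deg_x f = k iff c_0 != 0, and then LC_x f = c_0. *)
Definition x_expansion p x (k : nat) f (c : 'I_k.+1 -> R) : Prop :=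
  (forall i, projS p (c i)) /\ f = \sum_(i < k.+1) c i * x ^+ (k - i).

Definition LCx p x (k : nat) f (h : R) : Prop :=
  exists c, [/\ @x_expansion p x k f c, c ord0 != 0 & h = c ord0].

(* The forms of total degree t in I of degree k in x. *)
Definition Ixk I p x (k t : nat) f : Prop :=
  [/\ I f, f \is t.-homog & exists h, LCx p x k f h].

(* If f has total degree k then LC_x f is a nonzero constant and D f = Zk is
   closed in Proj(S), hence affine only when it is finite. *)
Definition D I p x (k : nat) f q : Prop :=
  Zk I p k q /\ exists2 h, LCx p x k f h & ~ q h.

(* The coefficients a of f restricted to the line over q, f of total degree t,
   as a binary form of degree k in x and y. *)
Definition restriction p x (k t : nat) f q y (a : 'I_k.+1 -> K) : Prop :=
  exists2 c, x_expansion p x f c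
           & forall i : 'I_k.+1, q (c i - a i *: y ^+ (t - k + i)).

End Projection.

Section RootLoci.
Context {K : closedFieldType}.

Definition binary_form k (a : 'I_k.+1 -> K) : {mpoly K[2]} :=
  \sum_(j < k.+1) a j *: ('X_ord0 ^+ (k - j) * 'X_ord_max ^+ j).

Definition proportional (L M : {mpoly K[2]}) : Prop :=
  exists u v : K, (u != 0) || (v != 0) /\ u *: L = v *: M.

Definition Xlam_open e (lam : 'I_e -> nat) k (a : 'I_k.+1 -> K) : Prop :=
  (exists i, a i != 0) /\
  exists (u : K) (L : 'I_e -> {mpoly K[2]}),
    [/\ u != 0, forall i, L i \is 1.-homog,
        forall i j, i != j -> ~ proportional (L i) (L j)
      & binary_form a = u *: \prod_i L i ^+ lam i].

End RootLoci.

(* Main.v *)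
Require Import Defs.
From HB Require Import structures.
From mathcomp Require Import all_boot all_order all_algebra.
From Stdlib Require Import Classical FunctionalExtensionality PropExtensionality.

Set Implicit Arguments.
Unset Strict Implicit.
Unset Printing Implicit Defensive.

Import GRing.Theory.
Local Open Scope ring_scope.

(** The projection is given by S = K[y_1,...,y_n] inside R = S[x], where the y_j
    are linear forms vanishing at p.  Over a point q of Proj S with coordinates b,
    the fiber lies on the line joining q to p.  Since the scheme avoids p, nothing
    is lost by removing p from this line, that is, by evaluating the coefficients
    of the expansion in powers of x at b: the fiber becomes the zero scheme on the
    affine line of an ideal of K[X], generated by a single polynomial w, whose
    degree is the length of the fiber and whose roots, with their multiplicities,
    are the divisor ([saturation_eq], [fiber_of_roots], [roots_of_fiber]).

    Let f in I have x-degree k and a leading coefficient that does not vanish at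
    b.  Then w divides the restriction of f, so the fiber has length at most k, and
    if the length is k, then the restriction of f is a scalar multiple of w.  This
    gives the last assertion: the multiplicities of the divisor are those of the
    roots of the binary form of f ([restriction_partition], [Xlam_open_roots]).

    The sets D f cover the fibers of length k by Nakayama's lemma: locally at q, R/I
    is a finite S-module, because I contains a form that is monic in x, and modulo q
    it is generated by 1, x, ..., x^(k-1).  This is proved by explicit divisions,
    each of which lowers by one the x-degree of an element of I whose leading
    coefficient does not vanish at b ([lower_degree], [Zk_covered]).

    Finally D f is affine.  Pseudo-division by f shows that, among the points where
    the leading coefficient h of f does not vanish, D f is the closed set where all
    coefficients of all elements of I of x-degree less than k vanish
    ([D_equations]).  If h has positive degree, the complement of its zero set is
    affine by the Veronese embedding ([principal_affine]).  If h is a constant, the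
    set is assumed finite, and another linear form that vanishes at none of its
    points takes the place of h ([finite_affine]). *)

(** * Homogeneous polynomials *)

Section Homogeneous.
Context {K : fieldType} {N : nat}.
Implicit Types (g h : {mpoly K[N]}) (v : 'I_N -> K).

Lemma dhomog_mdeg d g m : g \is d.-homog -> m \in msupp g -> mdeg m = d.
Proof. by move/dhomogP; apply. Qed.

Lemma dhomog_sum (I : Type) (r : seq I) (P : pred I) F d :
    (forall i, P i -> F i \is d.-homog) ->
  (\sum_(i <- r | P i) F i : {mpoly K[N]}) \is d.-homog.
Proof. exact: rpred_sum. Qed.

Lemma dhomogB d g h : g \is d.-homog -> h \is d.-homog -> g - h \is d.-homog.
Proof. exact: rpredB. Qed.

Lemma dhomog_scale d c g : g \is d.-homog -> c *: g \is d.-homog.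
Proof. exact: rpredZ. Qed.

Lemma dhomog_exp d i g : g \is d.-homog -> g ^+ i \is (d * i).-homog.
Proof. exact: dhomogMn. Qed.

Lemma dhomog_exp1 i g : g \is 1.-homog -> g ^+ i \is i.-homog.
Proof. by move/(dhomogMn i); rewrite mul1n. Qed.

Lemma meval_homogZ d g v s :
  g \is d.-homog -> g.@[fun i => s * v i] = s ^+ d * g.@[v].
Proof.
move=> gd; rewrite !mevalE mulr_sumr !big_seq.
apply: eq_bigr => m /(dhomog_mdeg gd) <-; rewrite mulrCA; congr (_ * _).
rewrite mdegE -prodrXr -big_split /=; apply: eq_bigr => i _.
by rewrite exprMn.
Qed.

Lemma pihomog_sum g : exists k, forall k', (k <= k')%N ->
  g = \sum_(d < k') pihomog mdeg d g.
Proof. by exists (msize g) => k' le; apply: pihomog_partitionE. Qed.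

(** Multiplication by a form of degree e shifts the grading, so it commutes with
    taking homogeneous components. *)
Lemma pihomogM d e g h : h \is e.-homog ->
  pihomog mdeg d (g * h) =
  if (e <= d)%N then pihomog mdeg (d - e) g * h else 0.
Proof.
move=> he; have [k gE] := pihomog_sum g.
rewrite {1}(gE k (leqnn k)) mulr_suml raddf_sum /=.
have hom i : pihomog mdeg i g * h \is (i + e).-homog.
  by apply: dhomogM => //; apply: pihomogP.
case: leqP => [le_ed|lt_de]; last first.
  apply: big1 => i _; apply: (pihomog_ne0 _ (hom i)).
  by rewrite gtn_eqF // (leq_trans lt_de) // leq_addl.
have [lt_k|le_k] := ltnP (d - e) k.
  rewrite (bigD1 (Ordinal lt_k)) //= big1 ?addr0 => [|i ne].
    by rewrite pihomog_dE //; have := hom (d - e)%N; rewrite subnK.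
  apply: (pihomog_ne0 _ (hom i)); apply: contraNneq ne => di.
  by rewrite -val_eqE /= -di addnK.
have z : pihomog mdeg (d - e) g = 0.
  rewrite (gE k (leqnn k)) raddf_sum /= big1 // => i _.
  apply: (@pihomog_ne0 _ _ _ i); last exact: pihomogP.
  by rewrite ltn_eqF // (leq_trans (ltn_ord i)).
rewrite z mul0r big1 // => i _; apply: (pihomog_ne0 _ (hom i)).
by rewrite ltn_eqF // -(subnK le_ed) ltn_add2r (leq_trans (ltn_ord i)).
Qed.

Lemma dhomog0_const g : g \is 0.-homog -> g = (g@_0%MM)%:MP.
Proof.
move=> g0; apply: msize1_polyC; rewrite msizeE big_seq.
apply: (big_ind (fun k => (k <= 1)%N)) => // [i j|m /(dhomog_mdeg g0) -> //].
by rewrite geq_max => -> ->.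
Qed.

Lemma linear_formE l : l \is 1.-homog -> l = \sum_i l@_U_(i) *: 'X_i :> {mpoly K[N]}.
Proof.
move=> l1; apply/mpolyP => m; rewrite raddf_sum /=.
have [m1|m1] := boolP (mdeg m == 1%N); last first.
  rewrite (dhomog_nemf_coeff l1 m1) big1 // => i _; rewrite mcoeffZ mcoeffX.
  by case: eqP => [Em|]; rewrite ?mulr0 //; rewrite -Em mdeg1 in m1.
case/mdeg1P: m1 => j /eqP ->; rewrite (bigD1 j) //= big1 ?addr0 => [|i ne].
  by rewrite mcoeffZ mcoeffXU eqxx mulr1.
by rewrite mcoeffZ mcoeffXU (negbTE ne) mulr0.
Qed.

Lemma meval_linear l v : l \is 1.-homog -> l.@[v] = \sum_i l@_U_(i) * v i.
Proof.
move=> l1; rewrite {1}(linear_formE l1) raddf_sum /=; apply: eq_bigr => i _.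
by rewrite mevalZ mevalXU.
Qed.

Lemma dhomog_prodX (I : finType) (F : I -> {mpoly K[N]}) (d m : I -> nat) :
  (forall i, F i \is (d i).-homog) ->
  \prod_i F i ^+ m i \is (\sum_i d i * m i)%N.-homog.
Proof.
move=> Fd; apply: (big_ind2 (fun g e => g \is e.-homog)).
- exact: dhomog1.
- by move=> *; apply: dhomogM.
- by move=> i _; apply: dhomogMn.
Qed.

End Homogeneous.

Lemma comp_linear_homog (K : fieldType) N M (l : N.-tuple {mpoly K[M]}) d (g : {mpoly K[N]}) :
    (forall i, tnth l i \is 1.-homog) -> g \is d.-homog ->
  g \mPo l \is d.-homog.
Proof.
move=> l1 gd; rewrite comp_mpolyE big_seq; apply: rpred_sum => m /(dhomog_mdeg gd) <-.
apply: rpredZ; rewrite mdegE (eq_bigr (fun i => 1 * m i)%N) => [|i _].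
  exact: (@dhomog_prodX _ _ _ _ (fun=> 1%N)).
by rewrite mul1n.
Qed.

(** * Point ideals, generated ideals and saturation *)

Lemma closed_poly_eq0 (K : closedFieldType) (P : {poly K}) :
  (forall s, P.[s] = 0) -> P = 0.
Proof.
move=> P0; apply/eqP; apply/negPn/negP => /closed_nonrootP [s].
by rewrite rootE P0 eqxx.
Qed.

Lemma pred_ext (T : Type) (P Q : T -> Prop) : (forall t, P t <-> Q t) -> P = Q.
Proof.
move=> PQ; apply: functional_extensionality => t.
exact: propositional_extensionality.
Qed.

Section PointIdeals.
Context {K : closedFieldType} {N : nat}.
Implicit Types (g h : {mpoly K[N]}) (a b : 'rV[K]_N).

Lemma meval_scale d g a s : g \is d.-homog ->
  g.@[(s *: a) 0] = s ^+ d * g.@[a 0].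
Proof.
by move=> gd; rewrite -(meval_homogZ _ _ gd); apply: meval_eq => i; rewrite mxE.
Qed.

Lemma point_ideal_homogE d g a : g \is d.-homog ->
  point_ideal a g <-> g.@[a 0] = 0.
Proof.
move=> gd; split=> [/(_ 1)|g0 s]; first by rewrite scale1r.
by rewrite (meval_scale _ _ gd) g0 mulr0.
Qed.

(** The restriction of g to the line through a is a polynomial in the scaling
    parameter whose coefficients are the values at a of the components of g; the
    field being infinite, it vanishes identically iff all of them do.  In
    particular point ideals are homogeneous. *)
Lemma point_idealP g a :
  point_ideal a g <-> forall d, (pihomog mdeg d g).@[a 0] = 0.
Proof.
have scaleE s k : (msize g <= k)%N ->
    g.@[(s *: a) 0] = \sum_(d < k) s ^+ d * (pihomog mdeg d g).@[a 0].
  move=> le; rewrite {1}(pihomog_partitionE le) raddf_sum /=.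
  by apply: eq_bigr => d _; apply/meval_scale/pihomogP.
split=> [g0 d|g0 s]; last first.
  by rewrite (scaleE s _ (leqnn _)) big1 // => i _; rewrite g0 mulr0.
pose k := maxn (msize g) d.+1.
suff /polyP/(_ d) : \poly_(i < k) (pihomog mdeg i g).@[a 0] = 0.
  by rewrite coef_poly coef0 leq_max ltnSn orbT.
apply: closed_poly_eq0 => s; rewrite horner_poly -[RHS](g0 s) (scaleE s k) ?leq_maxl //.
by apply: eq_bigr => i _; rewrite mulrC.
Qed.

Lemma point_ideal_is_ideal a : is_ideal (point_ideal a).
Proof.
split=> [s|g h g0 h0 s|g h h0 s]; first exact: meval0.
  by rewrite mevalD g0 h0 addr0.
by rewrite mevalM h0 mulr0.
Qed.

Lemma point_idealZ c a : c != 0 -> point_ideal (c *: a) = point_ideal a.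
Proof.
move=> c0; apply: pred_ext => g; split=> g0 s; last by rewrite scalerA.
by rewrite -(mulfVK c0 s) -scalerA.
Qed.

(** The linear forms a_i X_j - a_j X_i cut out the line through a. *)
Lemma point_ideal_sub a b : a != 0 ->
  (forall g, g \is 1.-homog -> point_ideal a g -> point_ideal b g) ->
  exists c, b = c *: a.
Proof.
move=> a0 ab; have /rV0Pn[i ai] := a0.
exists (b 0 i / a 0 i); apply/rowP => j; rewrite mxE.
pose l : {mpoly K[N]} := a 0 i *: 'X_j - a 0 j *: 'X_i.
have l1 : l \is 1.-homog by apply: rpredB; apply: rpredZ; rewrite dhomogX /= mdeg1.
have := ab l l1; rewrite !(point_ideal_homogE _ l1) /l !mevalB !mevalZ !mevalXU.
rewrite mulrC subrr => /(_ erefl) /eqP; rewrite subr_eq0 => /eqP E.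
by apply: (mulfI ai); rewrite E mulrCA mulrA mulfVK // mulrC.
Qed.

End PointIdeals.

Section IdealTheory.
Context {K : closedFieldType} {N : nat}.
Implicit Types (J T : pset K N) (g h : {mpoly K[N]}).

Lemma ideal_sum J : is_ideal J -> forall (I : Type) (r : seq I) (P : pred I) F,
  (forall i, P i -> J (F i)) -> J (\sum_(i <- r | P i) F i).
Proof. by case=> J0 JD _ I r P F JF; apply: big_ind. Qed.

Lemma idealZ J : is_ideal J -> forall (c : K) g, J g -> J (c *: g).
Proof. by case=> _ _ JM c g Jg; rewrite -mul_mpolyC; apply: JM. Qed.

Lemma idealB J : is_ideal J -> forall g h, J g -> J h -> J (g - h).
Proof.
move=> idJ g h Jg Jh; case: (idJ) => _ JD _; apply: JD => //.
by rewrite -scaleN1r; apply: idealZ.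
Qed.

Lemma mem_generated T g : T g -> ideal_generated T g.
Proof.
by move=> Tg; exists 1%N, (fun=> 1), (fun=> g); rewrite big_ord1 mul1r.
Qed.

(** The induction principle behind all the membership arguments below. *)
Lemma generated_sub T J : is_ideal J -> (forall g, T g -> J g) ->
  forall g, ideal_generated T g -> J g.
Proof.
move=> idJ TJ _ [s [c [t [Tt ->]]]]; apply: ideal_sum => // i _.
by case: idJ => _ _; apply; apply: TJ.
Qed.

Lemma generated_is_ideal T : is_ideal (ideal_generated T).
Proof.
split.
- by exists 0%N, (fun=> 0), (fun=> 0); split=> [[]|]; rewrite ?big_ord0.
- move=> _ _ [s [c [t [Tt ->]]]] [s' [c' [t' [Tt' ->]]]].
  pose glue (f : 'I_s -> {mpoly K[N]}) f' (i : 'I_(s + s')) :=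
    match split i with inl j => f j | inr j => f' j end.
  exists (s + s')%N, (glue c c'), (glue t t'); split=> [i|].
    by rewrite /glue; case: split.
  have splitl j : split (lshift s' j) = inl j :> 'I_s + 'I_s' by apply: (unsplitK (inl j)).
  have splitr j : split (rshift s j) = inr j :> 'I_s + 'I_s' by apply: (unsplitK (inr j)).
  by rewrite big_split_ord /=; congr (_ + _); apply: eq_bigr => j _;
    rewrite /glue ?splitl ?splitr.
- move=> g _ [s [c [t [Tt ->]]]]; exists s, (fun i => g * c i), t; split=> //.
  by rewrite mulr_sumr; apply: eq_bigr => i _; rewrite mulrA.
Qed.

(** The polynomials all of whose components lie in the generated ideal form an
    ideal, and it contains T. *)
Lemma generated_homogeneous T :
    (forall h d, T h -> ideal_generated T (pihomog mdeg d h)) ->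
  homogeneous_ideal (ideal_generated T).
Proof.
move=> homT; have idT := generated_is_ideal T; split=> // g d.
move: g; pose J h := forall d, ideal_generated T (pihomog mdeg d h).
suff idJ : is_ideal J.
  by move=> g /(generated_sub idJ (fun h Th d => homT h d Th)).
case: (idT) => T0 TD TM; rewrite /J; split=> [e|g h Jg Jh e|g h Jh e].
- by rewrite pihomog0.
- by rewrite pihomogD; apply: TD.
have [k gE] := pihomog_sum g.
rewrite mulrC {1}(gE k (leqnn k)) mulr_sumr raddf_sum /=.
apply: ideal_sum => // i _; rewrite (pihomogM _ _ (pihomogP _ _ _)).
by case: ifP => // _; rewrite mulrC; apply: TM.
Qed.

Lemma saturation_is_ideal J : is_ideal J -> is_ideal (saturation J).
Proof.
move=> [J0 JD JM]; split=> [|g h [s Jg] [s' Jh]|g h [s Jh]].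
- by exists 0%N => m _; rewrite mulr0.
- exists (maxn s s') => m md.
  (* a product with all monomials of degree t in J forces the same in degrees above t *)
  have deg_ge t f : (t <= mdeg m)%N -> (forall m, mdeg m = t -> J ('X_[m] * f)) ->
      J ('X_[m] * f).
    move=> le Jf; have [m1 [m2 [mE m1t]]] : exists m1 m2, m = (m1 + m2)%MM /\ mdeg m1 = t.
      elim: t le {Jf} => [|t IH] lt; first by exists 0%MM, m; rewrite add0m mdeg0.
      have [m1 [m2 [mE m1t]]] := IH (ltnW lt).
      have /existsP[i m2i] : [exists i, m2 i != 0%N].
        apply: contraTT lt; rewrite negb_exists => /forallP z.
        rewrite -leqNgt mE mdegD m1t -[leqRHS]addn0 leq_add2l leqn0 mdeg_eq0.
        by apply/eqP/mnmP => i; have := z i; rewrite negbK mnm0E => /eqP.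
      exists (m1 + U_(i))%MM, (m2 - U_(i))%MM; split; last by rewrite mdegD mdeg1 m1t addn1.
      rewrite mE -addmA [(U_(i) + _)%MM]addmC submK //.
      by apply/mnm_lepP => j; rewrite mnm1E; case: eqP => // <-; rewrite lt0n.
    by rewrite mE addmC mpolyXD -mulrA; apply/JM/Jf.
  rewrite mulrDr; apply: JD; [apply: deg_ge Jg|apply: deg_ge Jh];
    by rewrite md ?leq_maxl ?leq_maxr.
- by exists s => m md; rewrite mulrCA; apply/JM/Jh.
Qed.

(** A power of y is a combination of monomials of the same degree. *)
Lemma saturation_linear_power J y g : is_ideal J -> y \is 1.-homog ->
  saturation J g -> exists s, J (y ^+ s * g).
Proof.
move=> idJ y1 [s Jg]; exists s.
have ys : y ^+ s \is s.-homog by have := dhomogMn s y1; rewrite mul1n.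
rewrite (mpolyE (y ^+ s)) mulr_suml big_seq; apply: ideal_sum => // m.
by move/(dhomog_mdeg ys) => ms; rewrite -scalerAl; apply: idealZ => //; apply: Jg.
Qed.

(** Pigeonhole: a monomial of degree greater than N D is divisible by the D-th
    power of one of the N variables. *)
Lemma saturation_of_powers J g D : is_ideal J ->
  (forall i, J ('X_i ^+ D * g)) -> saturation J g.
Proof.
move=> [_ _ JM] JX; exists (N * D).+1 => m md.
have /existsP[i mi] : [exists i, (D < m i)%N].
  apply: contraPT md; rewrite negb_exists => /forallP le.
  apply/eqP; rewrite ltn_eqF // ltnS mdegE -[X in (X * D)%N]card_ord -sum_nat_const.
  by apply: leq_sum => i _; rewrite leqNgt.
rewrite -(@submK _ (U_(i) *+ D)%MM m); last first.
  apply/mnm_lepP => j; rewrite mulmnE mnm1E; case: eqP => [<-|_] //.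
  by rewrite mul1n ltnW.
by rewrite mpolyXD -mulrA -mpolyXn; apply/JM/JX.
Qed.

End IdealTheory.

(** * Coordinates adapted to the projection *)

Lemma mpoly_rmorph_eq (K : fieldType) N (A : comNzRingType)
    (f g : {rmorphism {mpoly K[N]} -> A}) :
    (forall c, f c%:MP = g c%:MP) -> (forall i, f 'X_i = g 'X_i) -> f =1 g.
Proof.
move=> fgC fgX h; rewrite (mpolyE h) !raddf_sum /=; apply: eq_bigr => m _.
rewrite -mul_mpolyC !rmorphM /= fgC mpolyXE_id !rmorph_prod /=; congr (_ * _).
by apply: eq_bigr => i _; rewrite !rmorphXn /= fgX.
Qed.

Section Coordinates.
Context {K : closedFieldType} {n : nat}.
Variables (p : 'rV[K]_n.+1) (x : {mpoly K[n.+1]}).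
Local Notation R := {mpoly K[n.+1]}.
Local Notation S0 := {mpoly K[n]}.

(** With S = K[y_1,...,y_n], the forms y_j = X_i - (p_i / x(p)) x, where i runs
    over all indices but one, vanish at p, and together with x they are a system
    of linear coordinates: the discarded index, the pivot, is one where x has a
    nonzero coefficient. *)
Definition slope i : K := p 0 i / x.@[p 0].
Definition pivot : 'I_n.+1 := odflt ord0 [pick i | x@_U_(i) != 0].
Definition ycoords : n.-tuple R :=
  [tuple 'X_(lift pivot j) - slope (lift pivot j) *: x | j < n].
(** The S-component of X_i in the decomposition X_i = (form in S) + slope * x.
    For the pivot it comes from the relation that the forms X_i - slope_i x,
    weighted by the coefficients of x, add up to 0. *)
Definition y_part i : S0 :=
  if unlift pivot i is Some j then 'X_j else
    - (x@_U_(pivot))^-1 *: \sum_j x@_U_(lift pivot j) *: 'X_j.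
Definition expand_var i : {poly S0} := (y_part i)%:P + (slope i)%:MP *: 'X.

End Coordinates.

(** The isomorphism R = S[x]: [expand] writes a polynomial in powers of x with
    coefficients in K[y_1,...,y_n], and [collapse], below, is its
    inverse. *)
HB.lock Definition expand {K : closedFieldType} {n : nat} (p : 'rV[K]_n.+1)
    (x g : {mpoly K[n.+1]}) : {poly {mpoly K[n]}} :=
  mmap (polyC \o @mpolyC n K) (expand_var p x) g.
HB.lock Definition liftS {K : closedFieldType} {n : nat} (p : 'rV[K]_n.+1)
    (x : {mpoly K[n.+1]}) (c : {mpoly K[n]}) : {mpoly K[n.+1]} :=
  c \mPo ycoords p x.

Section Morphisms.
Context {K : closedFieldType} {n : nat}.
Variables (p : 'rV[K]_n.+1) (x : {mpoly K[n.+1]}).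

Fact expand_is_zmod_morphism : zmod_morphism (expand p x).
Proof. by move=> f g; rewrite unlock; apply: rmorphB. Qed.
Fact expand_is_monoid_morphism : monoid_morphism (expand p x).
Proof. by rewrite unlock; split=> [|f g]; [apply: rmorph1|apply: rmorphM]. Qed.
Fact liftS_is_zmod_morphism : zmod_morphism (liftS p x).
Proof. by move=> f g; rewrite unlock; apply: rmorphB. Qed.
Fact liftS_is_monoid_morphism : monoid_morphism (liftS p x).
Proof. by rewrite unlock; split=> [|f g]; [apply: rmorph1|apply: rmorphM]. Qed.
HB.instance Definition _ := GRing.isZmodMorphism.Build _ _ (expand p x)
  expand_is_zmod_morphism.
HB.instance Definition _ := GRing.isMonoidMorphism.Build _ _ (expand p x)
  expand_is_monoid_morphism.
HB.instance Definition _ := GRing.isZmodMorphism.Build _ _ (liftS p x)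
  liftS_is_zmod_morphism.
HB.instance Definition _ := GRing.isMonoidMorphism.Build _ _ (liftS p x)
  liftS_is_monoid_morphism.
End Morphisms.

HB.lock Definition collapse {K : closedFieldType} {n : nat} (p : 'rV[K]_n.+1)
    (x : {mpoly K[n.+1]}) (F : {poly {mpoly K[n]}}) : {mpoly K[n.+1]} :=
  (map_poly (liftS p x) F).[x].
(** Restriction to the line joining p to the point b of the target, in the
    affine coordinate x that puts p at infinity: evaluate the coefficients of the
    expansion at b. *)
HB.lock Definition dehom {K : closedFieldType} {n : nat} (p : 'rV[K]_n.+1)
    (x : {mpoly K[n.+1]}) (b : 'rV[K]_n) (g : {mpoly K[n.+1]}) : {poly K} :=
  map_poly (meval (b 0)) (expand p x g).

Section Morphisms.
Context {K : closedFieldType} {n : nat}.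
Variables (p : 'rV[K]_n.+1) (x : {mpoly K[n.+1]}).

Fact collapse_is_zmod_morphism : zmod_morphism (collapse p x).
Proof. by move=> f g; rewrite unlock !rmorphB /= hornerD hornerN. Qed.
Fact collapse_is_monoid_morphism : monoid_morphism (collapse p x).
Proof.
by rewrite unlock; split=> [|f g]; rewrite ?rmorph1 ?hornerE // rmorphM /= hornerM.
Qed.
Fact dehom_is_zmod_morphism b : zmod_morphism (dehom p x b).
Proof. by move=> f g; rewrite unlock !rmorphB. Qed.
Fact dehom_is_monoid_morphism b : monoid_morphism (dehom p x b).
Proof. by rewrite unlock; split=> [|f g]; rewrite ?rmorph1 // !rmorphM. Qed.
HB.instance Definition _ := GRing.isZmodMorphism.Build _ _ (collapse p x)
  collapse_is_zmod_morphism.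
HB.instance Definition _ := GRing.isMonoidMorphism.Build _ _ (collapse p x)
  collapse_is_monoid_morphism.
HB.instance Definition _ b := GRing.isZmodMorphism.Build _ _ (dehom p x b)
  (dehom_is_zmod_morphism b).
HB.instance Definition _ b := GRing.isMonoidMorphism.Build _ _ (dehom p x b)
  (dehom_is_monoid_morphism b).
End Morphisms.

Section Projection.
Context {K : closedFieldType} {n : nat}.
Variables (p : 'rV[K]_n.+1) (x : {mpoly K[n.+1]}).
Local Notation R := {mpoly K[n.+1]}.
Local Notation S0 := {mpoly K[n]}.
Local Notation slope := (slope p x).
Local Notation pivot := (pivot x).
Local Notation ycoords := (ycoords p x).
Local Notation y_part := (y_part x).
Local Notation expand_var := (expand_var p x).
Local Notation expand := (expand p x).
Local Notation collapse := (collapse p x).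
Local Notation liftS := (liftS p x).
Local Notation dehom := (dehom p x).

(** The point of the line over b at which the affine coordinate x takes the value r. *)
Definition line_pt (b : 'rV[K]_n) (r : K) : 'rV[K]_n.+1 :=
  \row_i ((y_part i).@[b 0] + slope i * r).
Definition proj_pt (a : 'rV[K]_n.+1) : 'rV[K]_n := \row_j (tnth ycoords j).@[a 0].
(** The ideal in S of the closed point of Proj S with coordinates b. *)
Definition image_ideal (b : 'rV[K]_n) : pset K n.+1 := fun g =>
  exists2 c, point_ideal b c & g = liftS c.

Hypotheses (x1 : x \is 1.-homog) (xp : ~ point_ideal p x).

Lemma x_center_neq0 : x.@[p 0] != 0.
Proof. by apply/eqP => /(point_ideal_homogE _ x1). Qed.

Lemma pivot_neq0 : x@_U_(pivot) != 0.
Proof.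
rewrite /pivot; case: pickP => // x0; case/negP: x_center_neq0.
rewrite meval_linear // big1 // => i _.
by move/eqP: (x0 i) => /= ->; rewrite mul0r.
Qed.

Lemma sum_pivot (A : lmodType K) (F : 'I_n.+1 -> A) :
  \sum_i x@_U_(i) *: F i = x@_U_(pivot) *: F pivot +
    \sum_j x@_U_(lift pivot j) *: F (lift pivot j).
Proof. by rewrite (bigD1_ord pivot). Qed.

Lemma expandX i : expand 'X_i = expand_var i.
Proof. by rewrite unlock mmapX mmap1U. Qed.
Lemma expandC c : expand c%:MP = (c%:MP)%:P.
Proof. by rewrite unlock mmapC. Qed.
Lemma expandZ c g : expand (c *: g) = c%:MP *: expand g.
Proof. by rewrite -mul_mpolyC rmorphM /= expandC mul_polyC. Qed.

Lemma sum_y_part : \sum_i x@_U_(i) *: y_part i = 0.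
Proof.
rewrite sum_pivot /y_part unlift_none scalerA mulrN mulfV ?pivot_neq0 // scaleN1r.
by under [X in _ + X]eq_bigr do rewrite liftK; rewrite addNr.
Qed.

Lemma expand_x : expand x = 'X.
Proof.
rewrite (congr1 expand (linear_formE x1)) raddf_sum /=.
under eq_bigr do rewrite expandZ expandX /expand_var scalerDr scale_polyC scalerA -mpolyCM.
rewrite big_split /= -scaler_suml -rmorph_sum /=.
under eq_bigr do rewrite mul_mpolyC.
rewrite sum_y_part polyC0 add0r -rmorph_sum /=.
under eq_bigr do rewrite /slope mulrA.
by rewrite -mulr_suml -meval_linear // mulfV ?x_center_neq0 // mpolyC1 scale1r.
Qed.

Lemma liftSC c : liftS c%:MP = c%:MP.
Proof. by rewrite unlock comp_mpolyC. Qed.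
Lemma liftSZ c g : liftS (c *: g) = c *: liftS g.
Proof. by rewrite unlock comp_mpolyZ. Qed.
Lemma liftSX j : liftS 'X_j = 'X_(lift pivot j) - slope (lift pivot j) *: x.
Proof. by rewrite unlock comp_mpolyXU -tnth_nth tnth_mktuple. Qed.

Lemma expand_liftS c : expand (liftS c) = c%:P.
Proof.
apply: (@mpoly_rmorph_eq _ _ _ (expand \o liftS) polyC) => [a|j] /=.
  by rewrite liftSC expandC.
rewrite liftSX raddfB /= expandZ expandX expand_x.
by rewrite /expand_var /y_part liftK addrK.
Qed.

Lemma liftS_inj : injective liftS.
Proof. by move=> c c' /(congr1 expand); rewrite !expand_liftS => /polyC_inj. Qed.

Lemma collapseE F : collapse F = \sum_(i < size F) liftS F`_i * x ^+ i.
Proof.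
rewrite unlock horner_coef size_map_inj_poly ?rmorph0 //; last exact: liftS_inj.
by apply: eq_bigr => i _; rewrite coef_map.
Qed.

Lemma expand_collapse : cancel collapse expand.
Proof.
move=> F; rewrite collapseE rmorph_sum /= -[RHS]coefK poly_def.
apply: eq_bigr => i _.
by rewrite rmorphM rmorphXn /= expand_liftS expand_x mul_polyC.
Qed.

(** Both composites are ring morphisms, so it suffices to compare them on
    constants and variables; only the pivot variable needs a computation. *)
Lemma collapse_expand : cancel expand collapse.
Proof.
move=> g; apply: (@mpoly_rmorph_eq _ _ _ (collapse \o expand) idfun) => [c|i] /=.
  by rewrite expandC collapse.unlock map_polyC hornerC /= liftSC.
rewrite expandX collapse.unlock /expand_var rmorphD /= map_polyZ map_polyC map_polyX.
rewrite hornerD hornerC hornerZ hornerX /= liftSC mul_mpolyC.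
rewrite /y_part; case: unliftP => [j ->|->]; first by rewrite liftSX subrK.
rewrite liftSZ [liftS _]rmorph_sum /=.
under eq_bigr do rewrite liftSZ liftSX scalerBr scalerA.
rewrite sumrB -scaler_suml.
have -> : \sum_j x@_U_(lift pivot j) *: 'X_(lift pivot j) =
    x - x@_U_(pivot) *: 'X_pivot :> R.
  apply/esym/eqP; rewrite subr_eq addrC; apply/eqP.
  exact: etrans (linear_formE x1) (sum_pivot _).
have -> : \sum_j x@_U_(lift pivot j) * slope (lift pivot j) =
    1 - x@_U_(pivot) * slope pivot.
  have := @sum_pivot K^o slope; rewrite /slope.
  under eq_bigr do rewrite /GRing.scale /= mulrA.
  rewrite -mulr_suml -meval_linear // mulfV ?x_center_neq0 // => ->.
  by rewrite /= addrC addKr.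
have -> : x - x@_U_(pivot) *: 'X_pivot - (1 - x@_U_(pivot) * slope pivot) *: x =
    - (x@_U_(pivot) *: ('X_pivot - slope pivot *: x)) :> R.
  rewrite scalerBl scale1r scalerBr scalerA !opprB addrCA addrAC subrr add0r.
  by rewrite addrC.
by rewrite scalerN scaleNr opprK scalerA mulVf ?pivot_neq0 // scale1r subrK.
Qed.

Lemma expand_inj : injective expand.
Proof. exact: can_inj collapse_expand. Qed.

Lemma meval_liftS c (a : 'rV_n.+1) : (liftS c).@[a 0] = c.@[proj_pt a 0].
Proof.
by rewrite unlock comp_mpoly_meval; apply: meval_eq => j; rewrite mxE.
Qed.

Lemma dehomE b g : dehom b g = map_poly (meval (b 0)) (expand g).
Proof. by rewrite unlock. Qed.

Lemma dehomZ b c g : dehom b (c *: g) = c *: dehom b g.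
Proof.
by rewrite !dehomE expandZ map_polyZ /= mevalC.
Qed.

Lemma dehomD b g h : dehom b (g + h) = dehom b g + dehom b h.
Proof. exact: rmorphD. Qed.
Lemma dehomB b g h : dehom b (g - h) = dehom b g - dehom b h.
Proof. exact: rmorphB. Qed.
Lemma dehomM b g h : dehom b (g * h) = dehom b g * dehom b h.
Proof. exact: rmorphM. Qed.
Lemma dehomX b g i : dehom b (g ^+ i) = dehom b g ^+ i.
Proof. exact: rmorphXn. Qed.
Lemma dehom_sum b (I : Type) (r : seq I) (P : pred I) (F : I -> R) :
  dehom b (\sum_(i <- r | P i) F i) = \sum_(i <- r | P i) dehom b (F i).
Proof. exact: rmorph_sum. Qed.
Lemma dehom_prod b (I : Type) (r : seq I) (P : pred I) (F : I -> R) :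
  dehom b (\prod_(i <- r | P i) F i) = \prod_(i <- r | P i) dehom b (F i).
Proof. exact: rmorph_prod. Qed.

Lemma dehom_liftS b c : dehom b (liftS c) = (c.@[b 0])%:P.
Proof. by rewrite dehomE expand_liftS map_polyC. Qed.

Lemma dehom_x b : dehom b x = 'X.
Proof. by rewrite dehomE expand_x map_polyX. Qed.

(** Both sides are ring morphisms in g that agree on the variables. *)
Lemma meval_line_pt b r g : g.@[line_pt b r 0] = (dehom b g).[r].
Proof.
apply: (@mpoly_rmorph_eq _ _ _ (meval (line_pt b r 0)) (horner_eval r \o dehom b))
  => [c|i] /=.
  by rewrite mevalC /horner_eval dehomE expandC map_polyC hornerC /= mevalC.
rewrite mevalXU mxE /horner_eval dehomE expandX /expand_var rmorphD /= map_polyZ.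
by rewrite map_polyC map_polyX hornerD hornerC hornerZ hornerX /= mevalC.
Qed.

Lemma meval_liftS_line_pt c b r : (liftS c).@[line_pt b r 0] = c.@[b 0].
Proof. by rewrite meval_line_pt dehom_liftS hornerC. Qed.

Lemma meval_x_line_pt b r : x.@[line_pt b r 0] = r.
Proof. by rewrite meval_line_pt dehom_x hornerX. Qed.

Lemma line_pt_proj a : line_pt (proj_pt a) x.@[a 0] = a.
Proof.
apply/rowP => i; rewrite mxE -[RHS](mevalXU (a 0)) -(collapse_expand 'X_i) expandX.
rewrite collapse.unlock /expand_var rmorphD /= map_polyC map_polyZ map_polyX hornerD.
rewrite hornerC hornerZ hornerX /= liftSC mul_mpolyC mevalD mevalZ.
by rewrite meval_liftS.
Qed.

Lemma proj_line_pt b r : proj_pt (line_pt b r) = b.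
Proof.
by apply/rowP => j; rewrite mxE -(mevalXU (b 0)) -(meval_liftS_line_pt _ b r) liftS.unlock
  comp_mpolyXU -tnth_nth.
Qed.

Lemma proj_center : proj_pt p = 0.
Proof.
apply/rowP => j; rewrite !mxE tnth_mktuple mevalB mevalZ mevalXU /slope.
by rewrite mulfVK ?x_center_neq0 // subrr.
Qed.

Lemma y_part_homog i : y_part i \is 1.-homog.
Proof.
have X1 (j : 'I_n) : ('X_j : {mpoly K[n]}) \is 1.-homog by rewrite dhomogX /= mdeg1.
rewrite /y_part; case: unlift => // *; apply/rpredZ/rpred_sum => j _.
exact: rpredZ.
Qed.

Lemma ycoords_homog j : tnth ycoords j \is 1.-homog.
Proof. by rewrite tnth_mktuple rpredB // ?rpredZ // dhomogX /= mdeg1. Qed.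

Lemma liftS_homog d c : c \is d.-homog -> liftS c \is d.-homog.
Proof. by rewrite unlock; apply/comp_linear_homog/ycoords_homog. Qed.

Lemma line_pt0 r : line_pt 0 r = (r / x.@[p 0]) *: p.
Proof.
apply/rowP => i; rewrite !mxE (meval_linear _ (y_part_homog i)) big1 => [|j _].
  by rewrite add0r /slope mulrC mulrA mulrAC.
by rewrite mxE mulr0.
Qed.

Lemma line_ptZ c b r : line_pt (c *: b) (c * r) = c *: line_pt b r.
Proof.
apply/rowP => i; rewrite !mxE mulrDr mulrCA; congr (_ + _).
by rewrite (meval_scale _ _ (y_part_homog i)) expr1.
Qed.

Lemma proj_ptZ c a : proj_pt (c *: a) = c *: proj_pt a.
Proof.
by apply/rowP => j; rewrite !mxE (meval_scale _ _ (ycoords_homog j)) expr1.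
Qed.

Lemma line_pt_neq0 b r : b != 0 -> line_pt b r != 0.
Proof.
apply: contra_neq => E; rewrite -(proj_line_pt b r) E.
by have := proj_ptZ 0 0; rewrite !scale0r.
Qed.

Lemma proj_pt_eq0 a : proj_pt a = 0 -> exists c, a = c *: p.
Proof. by move=> E; rewrite -(line_pt_proj a) E line_pt0; eexists. Qed.

Lemma pihomog_liftS d c : pihomog mdeg d (liftS c) = liftS (pihomog mdeg d c).
Proof.
have [k cE] := pihomog_sum c; have {}cE := cE _ (leq_maxl k d.+1).
rewrite {1}cE rmorph_sum raddf_sum /= (bigD1 (Ordinal (leq_maxr k d.+1))) //=.
rewrite (pihomog_dE (liftS_homog (pihomogP _ _ _))) big1 ?addr0 // => i ne.
by apply: pihomog_ne0 (liftS_homog (pihomogP _ _ _)).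
Qed.

(** The expansion is graded: x has degree 1 and the coefficient of its i-th power
    in a form of degree d is a form of degree d - i. *)
Lemma expand_pihomog d g i : (expand (pihomog mdeg d g))`_i =
  if (i <= d)%N then pihomog mdeg (d - i) (expand g)`_i else 0.
Proof.
have xi j : x ^+ j \is j.-homog by have := dhomogMn j x1; rewrite mul1n.
pose F := \poly_(j < size (expand g))
  (if (j <= d)%N then pihomog mdeg (d - j) (expand g)`_j else 0).
suff -> : pihomog mdeg d g = collapse F.
  rewrite expand_collapse coef_poly; case: ltnP => // le.
  by rewrite nth_default // pihomog0 if_same.
apply: expand_inj; rewrite expand_collapse -{1}(collapse_expand g) collapseE.
rewrite [pihomog _ _ _]raddf_sum [expand _]rmorph_sum /F poly_def /=; apply: eq_bigr => j _.
rewrite (pihomogM _ _ (xi j)); case: ifP => _; last by rewrite rmorph0 scale0r.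
by rewrite pihomog_liftS rmorphM rmorphXn /= expand_liftS expand_x mul_polyC.
Qed.

Lemma expand_homog d g i : g \is d.-homog -> (expand g)`_i \is (d - i).-homog.
Proof.
move=> gd; rewrite -(pihomog_dE gd) expand_pihomog; case: ifP => _.
  exact: pihomogP.
exact: rpred0.
Qed.

Lemma expand_homog0 d g i : g \is d.-homog -> (d < i)%N -> (expand g)`_i = 0.
Proof. by move=> gd lt; rewrite -(pihomog_dE gd) expand_pihomog leqNgt lt. Qed.

Lemma size_expand_homog d g : g \is d.-homog -> (size (expand g) <= d.+1)%N.
Proof. by move=> gd; apply/leq_sizeP => j; apply: expand_homog0. Qed.

Lemma homog_liftS d c : liftS c \is d.-homog -> c \is d.-homog.
Proof. by move/(expand_homog 0); rewrite expand_liftS coefC eqxx subn0. Qed.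

(** The coefficient of x in the expansion of l is l(p) / x(p). *)
Lemma linear_in_S l : l \is 1.-homog -> point_ideal p l -> exists c, l = liftS c.
Proof.
move=> l1 /(point_ideal_homogE _ l1) lp.
exists (expand l)`_0; apply: expand_inj; rewrite expand_liftS.
apply/polyP => -[|[|i]]; rewrite coefC //=; last by rewrite (expand_homog0 l1).
rewrite (congr1 expand (linear_formE l1)) raddf_sum coef_sum /=.
under eq_bigr do rewrite expandZ expandX /expand_var coefZ coefD coefC coefZ coefX add0r
  mulr1 -mpolyCM /slope mulrA.
by rewrite -rmorph_sum -mulr_suml -(meval_linear _ l1) lp mul0r rmorph0.
Qed.

Lemma projSP g : projS p g <-> exists c, g = liftS c.
Proof.
split=> [[s [l [h [lS ->]]]]|[c ->]]; last first.
  exists n, ycoords, c; split=> [j|]; last by rewrite unlock.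
  split; first exact: ycoords_homog.
  apply/(point_ideal_homogE _ (ycoords_homog j)).
  by have /rowP/(_ j) := proj_center; rewrite !mxE.
have /fin_all_exists [c cE] i : exists c, tnth l i = liftS c.
  by have [l1 lp] := lS i; apply: linear_in_S.
exists (h \mPo [tuple c i | i < s]).
apply: (@mpoly_rmorph_eq _ _ _ (comp_mpoly l) (liftS \o comp_mpoly [tuple c i | i < s]))
  => [a|i] /=; first by rewrite !comp_mpolyC liftSC.
by rewrite !comp_mpolyXU -!tnth_nth tnth_mktuple cE.
Qed.

Lemma image_ideal_liftS b c : image_ideal b (liftS c) <-> point_ideal b c.
Proof. by split=> [[c' bc' /liftS_inj ->]|bc] //; exists c. Qed.

Lemma point_ideal_liftS a c : point_ideal a (liftS c) <-> point_ideal (proj_pt a) c.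
Proof.
by split=> H s; have := H s; rewrite meval_liftS proj_ptZ.
Qed.

Lemma image_ideal_scheme a : image_ideal (proj_pt a) = (fun g => projS p g /\ point_ideal a g).
Proof.
apply: pred_ext => g; split=> [[c bc ->]|[/projSP[c ->]]].
  by split; [apply/projSP; exists c|apply/point_ideal_liftS].
by move/point_ideal_liftS => ?; exists c.
Qed.

Lemma image_idealZ c b : c != 0 -> image_ideal (c *: b) = image_ideal b.
Proof. by move=> c0; rewrite /image_ideal point_idealZ. Qed.

Lemma image_ideal_eq b b' : b != 0 -> b' != 0 -> image_ideal b = image_ideal b' ->
  exists2 c, c != 0 & b' = c *: b.
Proof.
move=> b0 b'0 E; have [g g1|c Ec] := @point_ideal_sub _ _ b b' b0.
  by move=> /image_ideal_liftS; rewrite E => /image_ideal_liftS.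
by exists c => //; apply: contraNneq b'0 => c0; rewrite Ec c0 scale0r.
Qed.

End Projection.

Arguments expandZ {K n p x} c g.
Arguments expandC {K n p x} c.
Arguments expandX {K n p x} i.
Arguments liftSC {K n p x} c.
Arguments liftSZ {K n p x} c g.
Arguments meval_liftS {K n p x} c a.
Arguments dehomE {K n p x} b g.
Arguments dehomZ {K n p x} b c g.
Arguments meval_line_pt {K n p x} b r g.
Arguments line_pt0 {K n p x} r.
Arguments line_ptZ {K n p x} c b r.
Arguments proj_ptZ {K n p x} x1 c a.
Arguments liftS_homog {K n p x} x1 d c.
Arguments pihomog_liftS {K n p x} x1 d c.
Arguments image_idealZ {K n p x c} b.
Arguments point_ideal_liftS {K n p x} x1 a c.
Arguments dehomD {K n p x} b g h.
Arguments dehomB {K n p x} b g h.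
Arguments dehomM {K n p x} b g h.
Arguments dehomX {K n p x} b g i.
Arguments dehom_sum {K n p x} b I r P F.
Arguments dehom_prod {K n p x} b I r P F.

(** * Fibers as ideals of K[X] *)

Section Fibers.
Context {K : closedFieldType} {n : nat}.
Variables (p : 'rV[K]_n.+1) (x : {mpoly K[n.+1]}).
Local Notation R := {mpoly K[n.+1]}.
Local Notation S0 := {mpoly K[n]}.
Hypotheses (x1 : x \is 1.-homog) (xp : ~ point_ideal p x).
Implicit Types (g h j : R) (J : pset K n.+1).
Local Notation dehom := (dehom p x).
Local Notation expand := (expand p x).
Local Notation collapse := (collapse p x).
Local Notation liftS := (liftS p x).
Local Notation image_ideal := (image_ideal p x).
Local Notation line_pt := (line_pt p x).

(** Along the line Kp all y_j vanish, so that only the power x^d survives: a form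
    not vanishing at p is monic in x up to a nonzero scalar. *)
Lemma expand_top d g : g \is d.-homog ->
  (expand g)`_d = (g.@[p 0] / x.@[p 0] ^+ d)%:MP.
Proof.
move=> gd; have := expand_homog x1 xp d gd; rewrite subnn => /dhomog0_const cE.
have : g.@[p 0] = (dehom 0 g).[x.@[p 0]].
  by rewrite -meval_line_pt line_pt0 divff ?(x_center_neq0 x1 xp) // scale1r.
have le := size_expand_homog x1 xp gd.
rewrite (@horner_coef_wide _ d.+1); last first.
  by rewrite (leq_trans _ le) // dehomE size_poly.
rewrite big_ord_recr /= big1 ?add0r => [|i _].
  rewrite dehomE coef_map /= => ->; rewrite mulfK; last first.
    by rewrite expf_neq0 ?(x_center_neq0 x1 xp).
  by rewrite {2}cE mevalC.
rewrite dehomE coef_map /= -[in X in _.@[X]](scale0r (0 : 'rV[K]_n)).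
rewrite (meval_scale _ _ (expand_homog x1 xp i gd)) expr0n.
by rewrite subn_eq0 leqNgt ltn_ord /= !mul0r.
Qed.

Lemma dehom_surj b v : exists g, dehom b g = v.
Proof.
exists (collapse (map_poly (@mpolyC n K) v)).
rewrite dehomE (expand_collapse x1 xp); apply/polyP => i.
by rewrite !coef_map /= mevalC.
Qed.

Lemma dehom_pihomog_sum b g k : (msize g <= k)%N ->
  dehom b g = \sum_(d < k) dehom b (pihomog mdeg d g).
Proof. by move=> le; rewrite {1}(pihomog_partitionE le) dehom_sum. Qed.

Lemma size_dehom_homog b d g : g \is d.-homog -> (size (dehom b g) <= d.+1)%N.
Proof.
move=> gd; rewrite (leq_trans _ (size_expand_homog x1 xp gd)) //.
by rewrite dehomE size_poly.
Qed.

(** A form is determined by its dehomogenization: if all coefficients of the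
    expansion vanish at b, they belong to the ideal of b, as they are forms too. *)
Lemma dehom_homog_kernel b d g : g \is d.-homog -> dehom b g = 0 ->
  ideal_generated (image_ideal b) g.
Proof.
move=> gd g0; rewrite -(collapse_expand x1 xp g) (collapseE x1 xp).
have [_ _ JM] := generated_is_ideal (image_ideal b).
apply: ideal_sum => [|i _]; first exact: generated_is_ideal.
rewrite mulrC; apply: JM; apply: mem_generated; exists (expand g)`_i => //.
apply/(point_ideal_homogE _ (expand_homog x1 xp i gd)).
by have /polyP/(_ i) := g0; rewrite dehomE coef_map coef0.
Qed.

Lemma image_ideal_sub_center b g : image_ideal b g -> point_ideal p g.
Proof.
case=> c bc ->; apply/(point_ideal_liftS x1) => s.
by rewrite (proj_center x1 xp) scaler0 -(scale0r b).
Qed.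

Lemma image_ideal_pihomog b g d : image_ideal b g -> image_ideal b (pihomog mdeg d g).
Proof.
case=> c bc ->; rewrite (pihomog_liftS x1); exists (pihomog mdeg d c) => //.
apply/point_idealP => e; have [->|ne] := eqVneq d e.
  by rewrite pihomog_id; move/point_idealP: bc.
by rewrite (pihomog_ne0 ne (pihomogP _ _ _)) meval0.
Qed.

Section FixedPoint.
Variables (b : 'rV[K]_n) (y0 : S0).
Hypotheses (b0 : b != 0) (y01 : y0 \is 1.-homog) (y0b : y0.@[b 0] = 1).
Let y := liftS y0.
Let y1 : y \is 1.-homog. Proof. exact: liftS_homog. Qed.

Let dehom_y : dehom b y = 1.
Proof. by rewrite (dehom_liftS x1 xp) y0b. Qed.

Let dehom_yX N g : dehom b (y ^+ N * g) = dehom b g.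
Proof. by rewrite dehomM dehomX dehom_y expr1n mul1r. Qed.

Let yXhom N d g : g \is d.-homog -> y ^+ N * g \is (N + d).-homog.
Proof. by move=> gd; apply: dhomogM => //; apply: dhomog_exp1. Qed.

(** The subscheme defined by J does not contain p. *)
Definition avoids_center (J : pset K n.+1) : Prop :=
  exists d g, [/\ g \is d.-homog, J g & g.@[p 0] != 0].

(** Write the difference of g and j, made homogeneous with powers of y, and note
    that its dehomogenization is zero: it lies in the ideal of the line. *)
Lemma rehomogenize J d g j : homogeneous_ideal J -> (forall h, image_ideal b h -> J h) ->
  g \is d.-homog -> J j -> dehom b j = dehom b g -> exists N, J (y ^+ N * g).
Proof.
move=> [idJ homJ] qJ gd Jj E; have [_ JD JM] := idJ.
have [k le_jk le_dk] : exists2 k, (msize j <= k)%N & (d <= k)%N.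
  by exists (maxn (msize j) d); rewrite ?leq_maxl ?leq_maxr.
exists (k - d)%N.
pose w := y ^+ (k - d) * g - \sum_(e < k) y ^+ (k - e) * pihomog mdeg e j.
have wk : w \is k.-homog.
  apply: dhomogB; first by have := yXhom (k - d) gd; rewrite subnK.
  apply: dhomog_sum => e _; have := yXhom (k - e) (pihomogP mdeg e j).
  by rewrite (subnK (ltnW (ltn_ord e))); apply.
have w0 : dehom b w = 0.
  rewrite /w dehomB dehom_sum dehom_yX -E (dehom_pihomog_sum b le_jk).
  by under [X in _ - X]eq_bigr do rewrite dehom_yX; rewrite subrr.
have Jw := generated_sub idJ qJ (dehom_homog_kernel wk w0).
rewrite -(subrK (\sum_(e < k) y ^+ (k - e) * pihomog mdeg e j) (_ * g)).
apply: JD; first exact: Jw.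
apply: ideal_sum; first exact: idJ.
by move=> e _; apply: JM; apply: homJ.
Qed.

(** On the line over b the point p is the zero of y.  As J has a form mu that does
    not vanish at p, the forms mu and y^N have no common zero there, so all large
    powers of the variables lie in (mu, y^N) modulo the ideal of the line. *)
Lemma saturation_of_y_power J g N : is_ideal J -> (forall h, image_ideal b h -> J h) ->
  avoids_center J -> J (y ^+ N * g) -> saturation J g.
Proof.
move=> idJ qJ [M [mu [muM Jmu mup]]] Jg; have [_ JD JM] := idJ.
apply: (@saturation_of_powers _ _ _ _ (M * N)%N) => // i.
have XM : ('X_i ^+ M : R) \is M.-homog.
  by apply: dhomog_exp1; rewrite dhomogX /= mdeg1.
(* removing a multiple of mu kills the coefficient of x^M, and then y divides the
   restriction to the line *)
pose c := ('X_i ^+ M : R).@[p 0] / mu.@[p 0].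
pose u := 'X_i ^+ M - c *: mu.
have uM : u \is M.-homog by apply: dhomogB => //; apply: dhomog_scale.
have uM0 : (dehom b u)`_M = 0.
  rewrite dehomE coef_map /= (expand_top uM) /u mevalB mevalZ /c divfK // subrr.
  by rewrite mul0r mevalC.
pose v := \sum_(i < M) (dehom b u)`_i *: (y ^+ (M - i.+1) * x ^+ i).
have xi e : x ^+ e \is e.-homog by exact: dhomog_exp1.
have yvM : y * v \is M.-homog.
  rewrite mulr_sumr; apply: dhomog_sum => j _; rewrite -scalerAr; apply: dhomog_scale.
  have := yXhom (M - j) (xi j); rewrite subnK ?(ltnW (ltn_ord j)) //.
  by rewrite mulrA -exprS subnSK.
have yvE : dehom b (u - y * v) = 0.
  rewrite dehomB dehomM dehom_y mul1r dehom_sum; apply/eqP.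
  rewrite subr_eq0; apply/eqP.
  under eq_bigr do rewrite dehomZ dehom_yX dehomX (dehom_x x1 xp).
  rewrite -(@poly_def _ M (fun i => (dehom b u)`_i)); apply/polyP => e.
  rewrite [RHS]coef_poly; case: (ltngtP e M) => // [lt|-> //].
  by rewrite (nth_default 0 (leq_trans (size_dehom_homog b uM) lt)).
have Jw : J ('X_i ^+ M - y * v).
  have -> : 'X_i ^+ M - y * v = (u - y * v) + c *: mu by rewrite /u addrAC subrK.
  apply: JD; last by apply: (idealZ idJ); exact: Jmu.
  apply: (generated_sub idJ qJ); apply: dehom_homog_kernel yvE.
  by apply: dhomogB; [exact: uM|exact: yvM].
(* X_i^M = y v modulo J, hence X_i^(M N) g = v^N (y^N g) modulo J *)
rewrite exprM -(subrK ((y * v) ^+ N) (_ ^+ N)) mulrDl; apply: JD.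
  rewrite subrXX mulrAC mulrC; apply: (JM).
  by rewrite mulrC; apply: (JM); exact: Jw.
by rewrite exprMn mulrAC mulrC; apply: (JM); exact: Jg.
Qed.

(** Away from p, homogeneous ideals containing the ideal of the line are, up to
    saturation, the same thing as ideals of the affine coordinate ring K[X]. *)
Lemma saturationE J g : homogeneous_ideal J -> (forall h, image_ideal b h -> J h) ->
  avoids_center J ->
  saturation J g <->
  forall d, exists2 j, J j & dehom b j = dehom b (pihomog mdeg d g).
Proof.
move=> homJ qJ pJ; have [idJ JH] := homJ; split=> [sat d|img].
  have [s Js] := saturation_linear_power idJ y1 sat.
  exists (y ^+ s * pihomog mdeg d g); last exact: dehom_yX.
  have ys : y ^+ s \is s.-homog by exact: dhomog_exp1.
  have := JH _ (s + d)%N Js.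
  by rewrite mulrC (pihomogM _ _ ys) leq_addr addKn mulrC.
have [k gE] := pihomog_sum g; rewrite (gE k (leqnn k)).
apply: ideal_sum => [|d _]; first exact: saturation_is_ideal.
have [j Jj jE] := img d; have [N JN] := rehomogenize homJ qJ (pihomogP _ _ _) Jj jE.
exact: saturation_of_y_power JN.
Qed.

(** This turns the equality of two subschemes of the line, as stated by saturated
    ideals, into an equality of ideals of K[X]. *)
Lemma saturation_eq J1 J2 :
    homogeneous_ideal J1 -> (forall h, image_ideal b h -> J1 h) -> avoids_center J1 ->
    homogeneous_ideal J2 -> (forall h, image_ideal b h -> J2 h) -> avoids_center J2 ->
  (forall g, saturation J1 g <-> saturation J2 g) <->
  (forall u, (exists2 j, J1 j & dehom b j = u) <-> (exists2 j, J2 j & dehom b j = u)).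
Proof.
move=> h1 q1 p1 h2 q2 p2; split=> [E u|E g]; last first.
  rewrite !saturationE //; split=> H d; have [j Jj jE] := H d;
    by apply/E; exists j.
have half J J' : is_ideal J -> is_ideal J' ->
    (forall g, saturation J g -> saturation J' g) ->
    (exists2 j, J j & dehom b j = u) -> (exists2 j, J' j & dehom b j = u).
  move=> idJ idJ' JJ' [j Jj jE].
  have [|s Js] := saturation_linear_power idJ' y1 (JJ' j _).
    by exists 0%N => m _; case: idJ => _ _; apply.
  by exists (y ^+ s * j); rewrite ?dehom_yX.
by case: h1 h2 => [id1 _] [id2 _]; split; apply: half => // g /E.
Qed.

(** The fiber of the scheme of I over b is cut out by w on the affine line. *)
Definition restricts_to (I : pset K n.+1) (w : {poly K}) : Prop :=
  forall u, (exists2 g, I g & dehom b g = u) <-> w %| u.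

Lemma dehom_image_ideal g : image_ideal b g -> dehom b g = 0.
Proof.
by case=> c /(_ 1) bc ->; rewrite (dehom_liftS x1 xp) -[b]scale1r bc.
Qed.

Lemma dehom_generated_ideal I : is_ideal I -> forall u,
  (exists2 j, ideal_generated (fun h => I h \/ image_ideal b h) j & dehom b j = u) <->
  (exists2 g, I g & dehom b g = u).
Proof.
move=> [I0 ID IM] u; split=> [[j Jj <-]|[g Ig <-]]; last first.
  by exists g => //; apply: mem_generated; left.
suff idE : is_ideal (fun h => exists2 g, I g & dehom b g = dehom b h).
  apply: (generated_sub idE _ Jj) => h [Ih|/dehom_image_ideal ->]; first by exists h.
  by exists 0 => //; rewrite -(subrr 0) dehomB subrr.
split=> [|g h [g' Ig Eg] [h' Ih Eh]|g h [h' Ih Eh]].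
- by exists 0.
- by exists (g' + h'); [apply: ID|rewrite !dehomD Eg Eh].
- by exists (g * h'); [apply: IM|rewrite !dehomM Eh].
Qed.

Lemma dehom_generated_form P u :
  (exists2 j, ideal_generated (fun h => h = P \/ image_ideal b h) j & dehom b j = u) <->
  dehom b P %| u.
Proof.
split=> [[j Jj <-]|].
  suff idE : is_ideal (fun h => dehom b P %| dehom b h).
    by apply: (generated_sub idE _ Jj) => h [->|/dehom_image_ideal ->]; rewrite ?dvdpp ?dvdp0.
  split=> [|g h|g h]; first by rewrite -(subrr 0) dehomB subrr dvdp0.
    by rewrite dehomD; exact: dvdp_add.
  by rewrite dehomM; apply: dvdp_mull.
case/dvdpP => v ->; have [g <-] := dehom_surj b v.
exists (g * P); last by rewrite dehomM.
have [_ _ JM] := generated_is_ideal (fun h => h = P \/ image_ideal b h).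
by apply: JM; apply: mem_generated; left.
Qed.

Lemma generated_ideal_props I : homogeneous_ideal I -> avoids_center I ->
  let J := ideal_generated (fun h => I h \/ image_ideal b h) in
  [/\ homogeneous_ideal J, forall h, image_ideal b h -> J h & avoids_center J].
Proof.
move=> [_ homI] [d [g [gd Ig gp]]] J; split.
- apply: generated_homogeneous => h e [Ih|qh]; apply: mem_generated; [left|right].
    exact: homI.
  exact: image_ideal_pihomog.
- by move=> h qh; apply: mem_generated; right.
- by exists d, g; split=> //; apply: mem_generated; left.
Qed.

Lemma generated_form_props d P : P \is d.-homog -> P.@[p 0] != 0 ->
  let J := ideal_generated (fun h => h = P \/ image_ideal b h) in
  [/\ homogeneous_ideal J, forall h, image_ideal b h -> J h & avoids_center J].
Proof.
move=> Pd Pp J; have JP : J P by apply: mem_generated; left.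
have qJ h : image_ideal b h -> J h by move=> qh; apply: mem_generated; right.
split=> //; last by exists d, P.
apply: generated_homogeneous => h e [->|qh]; last exact/qJ/image_ideal_pihomog.
have [<-|ne] := eqVneq d e; first by rewrite (pihomog_dE Pd).
by rewrite (pihomog_ne0 ne Pd); case: (generated_is_ideal (fun h => h = P \/ image_ideal b h)).
Qed.

Lemma meval_liftS_p d c : c \is d.+1.-homog -> (liftS c).@[p 0] = 0.
Proof.
move=> cd; rewrite meval_liftS (proj_center x1 xp) -(scale0r (0 : 'rV[K]_n)).
by rewrite (meval_scale _ _ cd) expr0n mul0r.
Qed.

Lemma line_pt_inj r r' : point_ideal (line_pt b r) = point_ideal (line_pt b r') -> r = r'.
Proof.
move=> E; have [g _|c] := point_ideal_sub (line_pt_neq0 x1 xp r b0) (b := line_pt b r').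
  by rewrite E.
move=> Ec; have := congr1 (proj_pt p x) Ec.
rewrite (proj_ptZ x1) !(proj_line_pt x1 xp) => /eqP.
rewrite -subr_eq0 -{1}[b]scale1r -scalerBl.
rewrite scaler_eq0 (negbTE b0) orbF subr_eq0 => /eqP c1.
by rewrite -(meval_x_line_pt x1 xp b r) -(meval_x_line_pt x1 xp b r') Ec -c1 scale1r.
Qed.

(** The linear form x - r y vanishes at the point of affine coordinate r, and its
    dehomogenization is X - r. *)
Lemma fiber_of_roots I e (m : 'I_e -> nat) (r : 'I_e -> K) :
    homogeneous_ideal I -> avoids_center I -> injective r ->
    restricts_to I (\prod_i ('X - (r i)%:P) ^+ m i) ->
  fiber_is_divisor I (image_ideal b) m (fun i => point_ideal (line_pt b (r i))).
Proof.
move=> homI pI rI Iw; split.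
- move=> i; split; first by exists (line_pt b (r i)) => //; apply: line_pt_neq0.
  by move=> _ [c bc ->]; apply/(point_ideal_liftS x1); rewrite (proj_line_pt x1 xp).
- by move=> i i' /line_pt_inj/rI.
pose L i := x - r i *: y.
have L1 i : L i \is 1.-homog by apply: dhomogB => //; apply: dhomog_scale.
have dL i : dehom b (L i) = 'X - (r i)%:P.
  by rewrite /L dehomB (dehom_x x1 xp) dehomZ dehom_y alg_polyC.
have Lp i : (L i).@[p 0] != 0.
  by rewrite /L mevalB mevalZ (meval_liftS_p y01) mulr0 subr0 (x_center_neq0 x1 xp).
exists L; split=> //.
  move=> i; split.
    by apply/(point_ideal_homogE _ (L1 i)); rewrite meval_line_pt dL hornerXsubC subrr.
  have ker_ideal : is_ideal (fun h => dehom b h = 0).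
    split=> [|g h|g h]; rewrite ?dehomD ?dehomM; first by rewrite -(subrr 0) dehomB subrr.
      by move=> -> ->; rewrite addr0.
    by move=> ->; rewrite mulr0.
  by move/(generated_sub ker_ideal dehom_image_ideal)/eqP; rewrite dL polyXsubC_eq0.
pose P := \prod_i L i ^+ m i.
have PE : dehom b P = \prod_i ('X - (r i)%:P) ^+ m i.
  by rewrite /P dehom_prod; apply: eq_bigr => i _; rewrite dehomX dL.
have Pd : P \is (\sum_i 1 * m i)%N.-homog by apply: dhomog_prodX.
have Pp : P.@[p 0] != 0.
  rewrite /P rmorph_prod; apply/prodf_neq0 => i _.
  by rewrite /= rmorphXn; apply: expf_neq0; apply: Lp.
have [h1 q1 p1] := generated_ideal_props homI pI.
have [h2 q2 p2] := generated_form_props Pd Pp.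
apply/(saturation_eq h1 q1 p1 h2 q2 p2) => u; rewrite -/P.
case: homI => idI _.
by rewrite (dehom_generated_ideal idI) dehom_generated_form PE; apply: Iw.
Qed.

(** A point of the line other than p has an affine coordinate r, and a linear form
    vanishing there but not at p restricts to a multiple of X - r. *)
Lemma root_of_line_point a l : a != 0 -> (forall g, image_ideal b g -> point_ideal a g) ->
    l \is 1.-homog -> l.@[p 0] != 0 -> point_ideal a l ->
  exists r, point_ideal a = point_ideal (line_pt b r) /\
    exists2 c, c != 0 & dehom b l = c *: ('X - r%:P).
Proof.
move=> a0 qa l1 lp la; have [g g1 bg|c Ec] := @point_ideal_sub _ _ b (proj_pt p x a) b0.
  by apply/(point_ideal_liftS (p := p) x1); apply: qa; exists g.
have c0 : c != 0.
  apply: contraNneq a0 => c0; move: Ec; rewrite c0 scale0r => /(proj_pt_eq0 x1 xp)[s Es].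
  move/(point_ideal_homogE _ l1)/eqP: la; rewrite Es (meval_scale _ _ l1) expr1.
  by rewrite mulf_eq0 (negbTE lp) orbF => /eqP ->; rewrite scale0r.
pose r := x.@[a 0] / c.
have aE : point_ideal a = point_ideal (line_pt b r).
  by rewrite -(line_pt_proj x1 xp a) Ec -[x.@[_]](mulfVK c0) mulrC line_ptZ point_idealZ.
exists r; split=> //; exists (l.@[p 0] / x.@[p 0]).
  by rewrite mulf_neq0 ?invr_eq0 ?(x_center_neq0 x1 xp).
have sz := size_dehom_homog b l1.
have lead : (dehom b l)`_1 = l.@[p 0] / x.@[p 0].
  by rewrite dehomE coef_map /= (expand_top l1) mevalC.
have : (dehom b l).[r] = 0.
  by rewrite -meval_line_pt; apply/(point_ideal_homogE _ l1); rewrite -aE.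
rewrite (horner_coef_wide _ sz) !big_ord_recl big_ord0 /= addr0 expr0 mulr1 expr1.
rewrite lead => /eqP; rewrite addr_eq0 => /eqP l0.
apply/polyP => -[|[|i]]; rewrite coefZ coefB coefX coefC /= ?lead.
- by rewrite l0 sub0r mulrN.
- by rewrite subr0 mulr1.
- by rewrite subr0 mulr0 nth_default // (leq_trans sz).
Qed.

(** The divisor does not contain p, because the fiber does not; hence the linear
    forms with positive multiplicity restrict to polynomials of degree exactly 1,
    whose roots are the affine coordinates of the points of the divisor.  A point
    of multiplicity 0 may be any point of the line, including p. *)
Lemma roots_of_fiber I e (m : 'I_e -> nat) B :
    homogeneous_ideal I -> avoids_center I -> fiber_is_divisor I (image_ideal b) m B ->
  exists r : 'I_e -> K,
    (forall i, (0 < m i)%N -> B i = point_ideal (line_pt b (r i))) /\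
    restricts_to I (\prod_i ('X - (r i)%:P) ^+ m i).
Proof.
move=> homI pI [Bpt _ [L [L1 LB satE]]].
pose P := \prod_i L i ^+ m i.
have Pd : P \is (\sum_i 1 * m i)%N.-homog by apply: dhomog_prodX.
have [idI _] := homI; have [h1 q1 p1] := generated_ideal_props homI pI.
have Pp : P.@[p 0] != 0.
  have [d [g [gd Ig gp]]] := pI.
  (* if P vanished at p, so would x^s g for the form g of I that does not *)
  apply/eqP => /(point_ideal_homogE _ Pd) Pp.
  have sg : saturation (ideal_generated (fun h => I h \/ image_ideal b h)) g.
    exists 0%N => u _; case: (h1) => [[_ _ JM] _]; apply: JM.
    by apply: mem_generated; left.
  have [s] := saturation_linear_power (generated_is_ideal _) x1 (proj1 (satE g) sg).
  have PqP h : h = P \/ image_ideal b h -> point_ideal p h.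
    by case=> [->|/image_ideal_sub_center].
  move/(generated_sub (point_ideal_is_ideal p) PqP).
  move/(_ 1); rewrite scale1r mevalM rmorphXn /= => /eqP.
  by rewrite mulf_eq0 expf_eq0 (negbTE (x_center_neq0 x1 xp)) andbF (negbTE gp).
have Lp i : (0 < m i)%N -> (L i).@[p 0] != 0.
  move=> mi; have := Pp; rewrite /P rmorph_prod /= => /prodf_neq0/(_ i isT).
  by rewrite rmorphXn /= expf_eq0 mi.
have /fin_all_exists[r rP] i : exists r, (0 < m i)%N ->
    B i = point_ideal (line_pt b r) /\ exists2 c, c != 0 & dehom b (L i) = c *: ('X - r%:P).
  have [mi|] := ltnP 0 (m i); last by exists 0.
  have [[[a a0 Ba] qB] [BL _]] := (Bpt i, LB i); rewrite Ba in qB BL *.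
  by have [r] := root_of_line_point a0 qB (L1 i) (Lp i mi) BL; exists r.
exists r; split=> [i /rP[]//|u].
have [h2 q2 p2] := generated_form_props Pd Pp.
have /(_ u) := proj1 (saturation_eq h1 q1 p1 h2 q2 p2) satE.
rewrite (dehom_generated_ideal idI) dehom_generated_form => ->.
suff /eqp_dvdl -> : dehom b P %= \prod_i ('X - (r i)%:P) ^+ m i by [].
rewrite /P dehom_prod; elim/big_ind2: _ => // [|u1 v1 u2 v2|i _].
- exact: eqpxx.
- by move=> E1 E2; apply: eqp_trans (eqp_mulr _ E1) (eqp_mull _ E2).
rewrite dehomX; have [->|mi] := posnP (m i); first by rewrite !expr0 eqpxx.
by have [_ [c c0 ->]] := rP i mi; apply/eqp_exp/eqp_scale.
Qed.

End FixedPoint.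
End Fibers.

(** * Binary forms and coincident root loci *)

(** Dehomogenization of binary forms, with the second variable set to 1. *)
HB.lock Definition dehom2 {K : closedFieldType} (g : {mpoly K[2]}) : {poly K} :=
  mmap polyC (fun i : 'I_2 => if i == ord0 then 'X else 1) g.

Section BinaryForms.
Context {K : closedFieldType}.
Implicit Types (g h L M : {mpoly K[2]}).

Fact dehom2_is_zmod_morphism : zmod_morphism (@dehom2 K).
Proof. by move=> f g; rewrite unlock; apply: rmorphB. Qed.
Fact dehom2_is_monoid_morphism : monoid_morphism (@dehom2 K).
Proof. by rewrite unlock; split=> [|f g]; [apply: rmorph1|apply: rmorphM]. Qed.
HB.instance Definition _ := GRing.isZmodMorphism.Build _ _ (@dehom2 K)
  dehom2_is_zmod_morphism.
HB.instance Definition _ := GRing.isMonoidMorphism.Build _ _ (@dehom2 K)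
  dehom2_is_monoid_morphism.

Lemma dehom2_X0 : dehom2 ('X_ord0 : {mpoly K[2]}) = 'X.
Proof. by rewrite unlock mmapX mmap1U. Qed.
Lemma dehom2_X1 : dehom2 ('X_ord_max : {mpoly K[2]}) = 1.
Proof. by rewrite unlock mmapX mmap1U. Qed.
Lemma dehom2Z c g : dehom2 (c *: g) = c *: dehom2 g.
Proof. by rewrite -mul_mpolyC rmorphM /= unlock mmapC mul_polyC. Qed.

Lemma dehom2_mX m : dehom2 ('X_[m] : {mpoly K[2]}) = 'X^(m ord0).
Proof.
rewrite mpolyXE_id rmorph_prod /= big_ord_recl big_ord1 !rmorphXn /=.
have -> : lift ord0 ord0 = ord_max :> 'I_2 by apply: val_inj.
by rewrite dehom2_X0 dehom2_X1 expr1n mulr1.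
Qed.

Lemma mnm2_inj d (m m' : 'X_{1..2}) : mdeg m = d -> mdeg m' = d ->
  m ord0 = m' ord0 -> m = m'.
Proof.
rewrite !mdegE !big_ord_recl !big_ord0 /= !addn0 => <- E E0.
apply/mnmP => i; have [->|ne] := eqVneq i ord0; first exact: E0.
have -> : i = lift ord0 ord0 by apply: val_inj; case: i ne => [[|[]]].
by move: E; rewrite E0 => /addnI.
Qed.

(** In degree d the exponent of the first variable determines the monomial. *)
Lemma dehom2_inj d g h : g \is d.-homog -> h \is d.-homog -> dehom2 g = dehom2 h -> g = h.
Proof.
move=> gd hd E; apply/eqP; rewrite -subr_eq0; apply/eqP.
have {gd hd} fd := dhomogB gd hd.
have {E} : dehom2 (g - h) = 0 by rewrite rmorphB /= E subrr.
move: (g - h) fd => f fd f0; apply/mpolyP => m; rewrite mcoeff0.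
have [mf|/memN_msupp_eq0 //] := boolP (m \in msupp f).
have : (dehom2 f)`_(m ord0) = 0 by rewrite f0 coef0.
rewrite (congr1 dehom2 (mpolyE f)) rmorph_sum coef_sum (bigD1_seq m) ?msupp_uniq //=.
rewrite dehom2Z dehom2_mX coefZ coefXn eqxx mulr1.
rewrite big_seq_cond big1 ?addr0 // => m' /andP[m'f ne].
rewrite dehom2Z dehom2_mX coefZ coefXn; case: eqP => [E|]; last by rewrite mulr0.
case/negP: ne; apply/eqP; apply: (mnm2_inj (dhomog_mdeg fd m'f) (dhomog_mdeg fd mf)).
by rewrite E.
Qed.

Lemma linear2E L : L \is 1.-homog ->
  L = L@_U_(ord0) *: 'X_ord0 + L@_U_(ord_max) *: 'X_ord_max.
Proof.
move=> L1; rewrite {1}(linear_formE L1) big_ord_recl big_ord1.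
by have -> : lift ord0 ord0 = ord_max :> 'I_2 by apply: val_inj.
Qed.

Lemma dehom2_linear L : L \is 1.-homog ->
  dehom2 L = L@_U_(ord0) *: 'X + (L@_U_(ord_max))%:P.
Proof.
move=> L1; rewrite (congr1 dehom2 (linear2E L1)) rmorphD /= !dehom2Z dehom2_X0 dehom2_X1.
by rewrite alg_polyC.
Qed.

Lemma binary_form_homog k (a : 'I_k.+1 -> K) : binary_form a \is k.-homog.
Proof.
apply: dhomog_sum => j _; apply: dhomog_scale.
have X1 (i : 'I_2) : ('X_i : {mpoly K[2]}) \is 1.-homog by rewrite dhomogX /= mdeg1.
have := dhomogM (dhomog_exp1 (k - j) (X1 ord0)) (dhomog_exp1 j (X1 ord_max)).
by rewrite subnK // -ltnS.
Qed.

Lemma dehom2_binary_form k (a : 'I_k.+1 -> K) :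
  dehom2 (binary_form a) = \sum_(j < k.+1) a j *: 'X^(k - j).
Proof.
rewrite /binary_form rmorph_sum; apply: eq_bigr => j _.
by rewrite /= dehom2Z rmorphM !rmorphXn /= dehom2_X0 dehom2_X1 expr1n mulr1.
Qed.

Lemma dehom2_coef_k k (a : 'I_k.+1 -> K) : (dehom2 (binary_form a))`_k = a ord0.
Proof.
rewrite dehom2_binary_form coef_sum big_ord_recl /= subn0 coefZ coefXn eqxx mulr1.
rewrite big1 ?addr0 // => j _; rewrite coefZ coefXn gtn_eqF ?mulr0 //.
by rewrite ltn_subrL /=; case: (k) j => [[]|].
Qed.

(** As the leading coefficient a_0 is nonzero, no linear factor of positive
    multiplicity is proportional to the second variable.  So the factors are
    multiples of X_0 - r_i X_1, and they are pairwise non-proportional iff the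
    roots r_i are distinct. *)
Lemma Xlam_open_roots k e (lam : 'I_e -> nat) (a : 'I_k.+1 -> K) :
    a ord0 != 0 -> partition_of k lam ->
  Xlam_open lam a <-> exists2 r : 'I_e -> K, injective r &
    dehom2 (binary_form a) %= \prod_i ('X - (r i)%:P) ^+ lam i.
Proof.
move=> a0 [lam0 lamk]; split=> [[_ [u [L [u0 L1 Lprop aE]]]]|[r rI rE]].
  pose al i := (L i)@_U_(ord0); pose be i := (L i)@_U_(ord_max).
  have binE : dehom2 (binary_form a) = u *: \prod_i (al i *: 'X + (be i)%:P) ^+ lam i.
    rewrite aE dehom2Z rmorph_prod; congr (_ *: _); apply: eq_bigr => i _.
    by rewrite rmorphXn /= dehom2_linear.
  have al0 i : al i != 0.
    apply: contraNneq a0 => ali.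
    (* evaluation at (1, 0) picks a_0 on the left and the product of the
     coefficients al i on the right *)
    have := congr1 (meval (fun j : 'I_2 => if j == ord0 then 1 else 0)) aE.
    rewrite mevalZ rmorph_prod /= (bigD1 i) //= rmorphXn /= (meval_linear _ (L1 i)).
    rewrite big_ord_recl big_ord1 /= -/(al i) ali mul0r mulr0 addr0 expr0n.
    rewrite gtn_eqF ?lam0 // mul0r mulr0 => aE0.
    apply/eqP; rewrite -[RHS]aE0 /binary_form rmorph_sum big_ord_recl /= big1 => [|j _].
      by rewrite mevalZ mevalM !rmorphXn /= !mevalXU /= expr1n expr0 !mulr1 addr0.
    by rewrite mevalZ mevalM !rmorphXn /= !mevalXU /= expr0n !mulr0.
  exists (fun i => - be i / al i).
    move=> i j rij; apply/eqP; apply: contraT => /Lprop[]; exists (al j), (al i).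
    split; first by rewrite al0.
    rewrite (linear2E (L1 i)) (linear2E (L1 j)) !scalerDr !scalerA -/(al i) -/(al j).
    rewrite mulrC; congr (_ + _ *: _); rewrite -/(be i) -/(be j).
    have {rij} E : be i / al i = be j / al j by apply: oppr_inj; rewrite -!mulNr.
    by rewrite -[be i](divfK (al0 i)) E mulrA [al j * _]mulrC divfK ?al0 // mulrC.
  apply: (@eqp_trans _ (\prod_i (al i *: 'X + (be i)%:P) ^+ lam i)).
    by rewrite binE eqp_scale.
  elim/big_ind2: _ => // [|u1 v1 u2 v2 E1 E2|i _]; first exact: eqpxx.
    exact: eqp_trans (eqp_mulr _ E1) (eqp_mull _ E2).
  apply: eqp_exp; have -> : al i *: 'X + (be i)%:P = al i *: ('X - (- be i / al i)%:P).
    by rewrite scalerBr scale_polyC mulrCA mulfV // mulr1 polyCN opprK.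
  exact: eqp_scale.
split; first by exists ord0.
have [c c0 cE] : exists2 c, c != 0 &
    dehom2 (binary_form a) = c *: \prod_i ('X - (r i)%:P) ^+ lam i.
  have := eqpfP rE; set c := _ / _ => E; exists c => //.
  apply: contraNneq a0 => c0; rewrite -dehom2_coef_k E c0 scale0r coef0 //.
pose L i : {mpoly K[2]} := 'X_ord0 - r i *: 'X_ord_max.
have L1 i : L i \is 1.-homog.
  by apply: dhomogB; last apply: dhomog_scale; rewrite dhomogX /= mdeg1.
have L0E i : (L i)@_U_(ord0) = 1.
  by rewrite mcoeffB mcoeffZ !mcoeffXU /= mulr0 subr0.
have L1E i : (L i)@_U_(ord_max) = - r i.
  by rewrite mcoeffB mcoeffZ !mcoeffXU /= mulr1 sub0r.
exists c, L; split=> // [i j ne [u [v [uv E]]]|].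
  have := congr1 (mcoeff U_(ord0)) E; have := congr1 (mcoeff U_(ord_max)) E.
  rewrite !mcoeffZ !L0E !L1E !mulr1 => E1 uvE; rewrite uvE orbb in uv.
  move: E1; rewrite uvE !mulrN => /oppr_inj/(mulfI uv)/rI/eqP.
  by rewrite (negbTE ne).
apply: (@dehom2_inj k); first exact: binary_form_homog.
  apply: dhomog_scale; rewrite -lamk (eq_bigr (fun i => 1 * lam i)%N) => [|i _].
    exact: dhomog_prodX.
  by rewrite mul1n.
rewrite cE dehom2Z rmorph_prod; congr (_ *: _); apply: eq_bigr => i _.
by rewrite rmorphXn /= dehom2_linear // L0E L1E scale1r polyCN.
Qed.

End BinaryForms.

(** * Fibers of a given length *)

Lemma exists_linear_one (K : closedFieldType) n (b : 'rV[K]_n) : b != 0 ->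
  exists2 y : {mpoly K[n]}, y \is 1.-homog & y.@[b 0] = 1.
Proof.
case/rV0Pn => i bi; exists ((b 0 i)^-1 *: 'X_i).
  by apply: dhomog_scale; rewrite dhomogX /= mdeg1.
by rewrite mevalZ mevalXU mulVf.
Qed.

Lemma size_prod_roots (K : fieldType) e (m : 'I_e -> nat) (r : 'I_e -> K) :
  size (\prod_i ('X - (r i)%:P) ^+ m i) = (\sum_i m i).+1.
Proof.
rewrite size_prod => [|i _]; last by rewrite expf_neq0 ?polyXsubC_eq0.
under eq_bigr do rewrite size_exp_XsubC -addn1.
by rewrite big_split /= sum1_card -addSn addnK.
Qed.

(** Group the roots of w by value. *)
Lemma closed_poly_roots (K : closedFieldType) k (w : {poly K}) : size w = k.+1 ->
  exists e (m : 'I_e -> nat) (r : 'I_e -> K),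
    [/\ injective r, (\sum_i m i)%N = k & w %= \prod_i ('X - (r i)%:P) ^+ m i].
Proof.
move=> wk; have [s wE] := closed_field_poly_normal w.
have lw : lead_coef w != 0 by rewrite lead_coef_eq0 -size_poly_eq0 wk.
pose r (i : 'I_(size (undup s))) := (undup s)`_i.
pose m i := count_mem (r i) s.
have E : w %= \prod_i ('X - (r i)%:P) ^+ m i.
  rewrite {1}wE -(prodr_undup_exp_count s xpredT) (big_nth 0) big_mkord.
  exact: eqp_scale.
exists (size (undup s)), m, r; split=> //.
  move=> i j /eqP; rewrite nth_uniq ?undup_uniq // => /eqP; exact: val_inj.
by apply: succn_inj; rewrite -(size_prod_roots m r) -(eqp_size E).
Qed.

Section FibersOfDegree.
Context {K : closedFieldType} {n : nat}.
Variables (p : 'rV[K]_n.+1) (x : {mpoly K[n.+1]}) (I : pset K n.+1).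
Local Notation R := {mpoly K[n.+1]}.
Local Notation S0 := {mpoly K[n]}.
Implicit Types (g h f : R) (b : 'rV[K]_n) (q : pset K n.+1).
Local Notation dehom := (dehom p x).
Local Notation expand := (expand p x).
Local Notation collapse := (collapse p x).
Local Notation liftS := (liftS p x).
Local Notation image_ideal := (image_ideal p x).
Local Notation line_pt := (line_pt p x).
Local Notation restricts_to b w := (restricts_to p x b I w).
Hypotheses (homI : homogeneous_ideal I).
Hypotheses (p_neq0 : p != 0) (p_notin_Z : ~ scheme_pt I (point_ideal p)).
Hypotheses (x1 : x \is 1.-homog) (xp : ~ point_ideal p x).

Let idI : is_ideal I. Proof. by case: homI. Qed.

(** A polynomial of I outside the ideal of p has a component that does not vanish
    at p. *)
Lemma ideal_avoids_center : avoids_center p I.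
Proof.
have [g Ig gp] : exists2 g, I g & ~ point_ideal p g.
  apply: NNPP => H; apply: p_notin_Z; split; first by exists p.
  by move=> g Ig; apply: NNPP => gp; apply: H; exists g.
have [d gd] : exists d, (pihomog mdeg d g).@[p 0] <> 0.
  apply: NNPP => H; apply/gp/point_idealP => d.
  by apply: NNPP => gd; apply: H; exists d.
exists d, (pihomog mdeg d g); split; first exact: pihomogP.
  by case: homI => _; apply.
exact/eqP.
Qed.

Lemma imageZ_image_ideal q : imageZ I p q -> exists2 b, b != 0 & q = image_ideal b.
Proof.
case=> _ [[a a0 ->] Ia] ->; exists (proj_pt p x a); last by rewrite (image_ideal_scheme x1 xp).
apply/eqP => /(proj_pt_eq0 x1 xp)[c ac]; apply: p_notin_Z; split; first by exists p.
rewrite -(@point_idealZ _ _ c) -?ac //.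
by apply: contraNneq a0 => c0; rewrite ac c0 scale0r.
Qed.

Lemma imageZ_of_root b r : b != 0 ->
  (forall g, I g -> (dehom b g).[r] = 0) -> imageZ I p (image_ideal b).
Proof.
move=> b0 Ir; exists (point_ideal (line_pt b r)).
  split; first by exists (line_pt b r) => //; apply: line_pt_neq0.
  move=> g Ig; apply/point_idealP => d; rewrite meval_line_pt; apply: Ir.
  by case: homI => _; apply.
by rewrite -(image_ideal_scheme x1 xp) (proj_line_pt x1 xp).
Qed.

Lemma Zk_restricts k b : b != 0 -> Zk I p k (image_ideal b) ->
  exists2 w : {poly K}, size w = k.+1 & restricts_to b w.
Proof.
move=> b0 [_ [e [m [B [fib mk]]]]].
have [y y1 yb] := exists_linear_one b0.
have [r [_ Iw]] := roots_of_fiber x1 xp b0 y1 yb homI ideal_avoids_center fib.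
by exists (\prod_i ('X - (r i)%:P) ^+ m i) => //; rewrite size_prod_roots mk.
Qed.

Lemma restricts_eqp b w w' : w %= w' -> restricts_to b w -> restricts_to b w'.
Proof. by move=> E Iw u; rewrite -(eqp_dvdl _ E); apply: Iw. Qed.

Lemma restricts_uniq b w w' : restricts_to b w -> restricts_to b w' -> w %= w'.
Proof.
move=> Iw Iw'; apply/andP; split.
  by apply/Iw/Iw'.
by apply/Iw'/Iw.
Qed.

Lemma restricts_Zk k b (w : {poly K}) : (0 < k)%N -> b != 0 -> size w = k.+1 ->
  restricts_to b w -> Zk I p k (image_ideal b).
Proof.
move=> k0 b0 wk Iw; split.
  have [r wr] : exists r, root w r by apply/closed_rootP; rewrite wk; case: (k) k0.
  apply: (@imageZ_of_root b r) => // g Ig.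
  have /dvdpP[v ->] : w %| dehom b g by apply/Iw; exists g.
  by rewrite hornerM (rootP wr) mulr0.
have [e [m [r [rI mk E]]]] := closed_poly_roots wk.
have [y y1 yb] := exists_linear_one b0.
exists e, m, (fun i => point_ideal (line_pt b (r i))); split=> //.
apply: (fiber_of_roots x1 xp b0 y1 yb homI ideal_avoids_center rI).
exact: restricts_eqp Iw.
Qed.

(** Division with remainder in S[x], after multiplication by a power of the
    leading coefficient; the remainder is still in I. *)
Lemma pseudo_division (f g : R) : I f -> I g -> expand f != 0 ->
  exists (s : nat) (Q : {poly S0}) (r : R), [/\ I r, (size (expand r) < size (expand f))%N &
    lead_coef (expand f) ^+ s *: expand g = Q * expand f + expand r].
Proof.
move=> If Ig f0; have [_ ID IM] := idI.
pose lc := lead_coef (expand f); pose s := scalp (expand g) (expand f).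
have E : lc ^+ s *: expand g = expand g %/ expand f * expand f + expand g %% expand f.
  exact: Pdiv.Idomain.divp_eq.
exists s, (expand g %/ expand f), (collapse (expand g %% expand f)).
rewrite (expand_collapse x1 xp); split; last exact: E.
  have -> : expand g %% expand f =
      expand (liftS (lc ^+ s) * g - collapse (expand g %/ expand f) * f).
    rewrite rmorphB !rmorphM /= (expand_liftS x1 xp) (expand_collapse x1 xp).
    by rewrite mul_polyC E addrC addKr.
  rewrite (collapse_expand x1 xp); apply: (idealB idI); exact: IM.
by rewrite Pdiv.Idomain.ltn_modp.
Qed.

Definition has_degree_at b N (f : R) : Prop :=
  size (expand f) = N.+1 /\ ((expand f)`_N).@[b 0] != 0.

(** Nakayama's lemma in effective form.  Divide x^(N-k) g1, whose restriction to
    the line has degree N, by f, of degree N+1 there: the quotient must restrict to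
    zero, so that the remainder restricts to a nonzero multiple of x^(N-k) g1 and
    has x-degree exactly N, with a leading coefficient that does not vanish at b. *)
Lemma lower_degree b k N g1 : I g1 -> size (dehom b g1) = k.+1 -> (k <= N)%N ->
  (exists2 f, I f & has_degree_at b N.+1 f) -> exists2 f, I f & has_degree_at b N f.
Proof.
move=> Ig1 g1k kN [f If [fN fb]]; have [_ _ IM] := idI.
have f0 : expand f != 0 by rewrite -size_poly_eq0 fN.
have [s [Q [r [Ir rf E]]]] := pseudo_division If (IM (x ^+ (N - k)) g1 Ig1) f0.
exists r; first exact: Ir.
rewrite fN in rf.
have fbE : size (dehom b f) = N.+2.
  by rewrite dehomE size_map_poly_id0 ?fN // lead_coefE fN.
pose c := (lead_coef (expand f)).@[b 0] ^+ s.
have c0 : c != 0 by rewrite expf_neq0 // lead_coefE fN.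
have gbE : size (c *: ('X^(N - k) * dehom b g1)) = N.+1.
  rewrite size_scale // mulrC size_mulXn; last by rewrite -size_poly_eq0 g1k.
  by rewrite g1k addnS subnK.
have [Qb Eb] : exists Qb : {poly K},
    c *: ('X^(N - k) * dehom b g1) = Qb * dehom b f + dehom b r.
  exists (map_poly (meval (b 0)) Q); have := congr1 (map_poly (meval (b 0))) E.
  rewrite rmorphD !rmorphM map_polyZ !rmorphM !rmorphXn /=.
  by rewrite (expand_x x1 xp) map_polyX -!dehomE.
have rb : (size (dehom b r) <= N.+1)%N by rewrite dehomE (leq_trans (size_poly _ _)).
have Q0 : Qb = 0.
  have fb0 : dehom b f != 0 by rewrite -size_poly_eq0 fbE.
  apply/eqP; apply: contraT => Q0.
  have : (size (Qb * dehom b f)%R <= N.+1)%N.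
    rewrite -(addrK (dehom b r) (_ * _)) -Eb (leq_trans (size_polyD _ _)) //.
    by rewrite size_polyN geq_max gbE leqnn.
  rewrite size_mul // fbE addnS /= addnS ltnS leqNgt -{1}[N]add0n ltn_add2r.
  by rewrite size_poly_gt0 Q0.
have rbE : size (dehom b r) = N.+1 by rewrite -gbE Eb Q0 mul0r add0r.
have lead_b : (dehom b r)`_N != 0.
  by rewrite -[N]/(N.+1.-1) -rbE -lead_coefE lead_coef_eq0 -size_poly_eq0 rbE.
split; last by rewrite dehomE coef_map in lead_b.
by apply/anti_leq; rewrite -ltnS rf -[X in (X <= _)%N]rbE dehomE size_poly.
Qed.

(** Start from x^k mu, where mu in I does not vanish at p and is therefore monic in
    x up to a scalar, and lower the degree one by one to k with [lower_degree]. *)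
Lemma exists_degree_at b k (w : {poly K}) : size w = k.+1 -> restricts_to b w ->
  exists2 f, I f & has_degree_at b k f.
Proof.
move=> wk Iw; have [_ _ IM] := idI.
have [g1 Ig1 g1E] : exists2 g, I g & dehom b g = w by apply/Iw; apply: dvdpp.
rewrite -g1E in wk.
have [M [mu [muM Imu mup]]] := ideal_avoids_center.
have top : exists2 f, I f & has_degree_at b (k + M) f.
  exists (x ^+ k * mu); first exact: IM.
  have muE : ((expand mu)`_M).@[b 0] != 0.
    rewrite (expand_top x1 xp muM) mevalC mulf_neq0 ?invr_eq0 ?expf_neq0 //.
    exact: (x_center_neq0 x1 xp).
  have mu_neq0 : (expand mu)`_M != 0 by apply: contraNneq muE => ->; rewrite meval0.
  have muS : size (expand mu) = M.+1.
    apply/anti_leq; rewrite (size_expand_homog x1 xp muM) ltnNge.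
    by apply: contra mu_neq0 => le; rewrite nth_default.
  rewrite /has_degree_at rmorphM rmorphXn /= (expand_x x1 xp) mulrC.
  rewrite size_mulXn ?muS ?addnS //; last by rewrite -size_poly_eq0 muS.
  by rewrite coefMXn ltnNge leq_addr addKn.
elim: M {muM} top => [|M IH] top; first by rewrite addn0 in top.
apply: IH; apply: (lower_degree Ig1 wk (leq_addr M k)).
by rewrite -addnS.
Qed.

Lemma expand_expansion k f : size (expand f) = k.+1 ->
  x_expansion p x f (fun i : 'I_k.+1 => liftS (expand f)`_(k - i)).
Proof.
move=> fk; split; first by move=> i; apply/(projSP x1 xp); eexists.
rewrite -{1}(collapse_expand x1 xp f) (collapseE x1 xp) fk.
rewrite (reindex_inj rev_ord_inj) /=; apply: eq_bigr => i _.
by rewrite subSS.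
Qed.

(** The expansion in powers of x is unique, since [expand] is a bijection. *)
Lemma LCxE k f h : LCx p x k f h <->
  size (expand f) = k.+1 /\ h = liftS (expand f)`_k.
Proof.
split=> [[c [[cS fE] c0 ->]]|[fk ->]]; last first.
  exists (fun i : 'I_k.+1 => liftS (expand f)`_(k - i)); split=> /=.
  - exact: expand_expansion.
  - rewrite subn0; apply/eqP => /(congr1 expand).
    rewrite (expand_liftS x1 xp) rmorph0 => /eqP; rewrite polyC_eq0 => lk.
    have : lead_coef (expand f) != 0 by rewrite lead_coef_eq0 -size_poly_eq0 fk.
    by rewrite lead_coefE fk lk.
  - by rewrite subn0.
have /fin_all_exists [d dE] (i : 'I_k.+1) : exists d, c i = liftS d by apply/(projSP x1 xp).
have fE' : expand f = \poly_(i < k.+1) d (inord (k - i)).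
  rewrite fE rmorph_sum /= (reindex_inj rev_ord_inj) poly_def /=; apply: eq_bigr => i _.
  have le : (i <= k)%N by rewrite -ltnS.
  rewrite rmorphM rmorphXn /= (expand_x x1 xp) dE (expand_liftS x1 xp) mul_polyC subSS.
  by rewrite subKn //; congr (d _ *: _); apply: val_inj; rewrite /= inordK // ltnS leq_subr.
have d0 : d (inord (k - k)) = d ord0 by congr d; apply: val_inj; rewrite /= inordK subnn.
have dn0 : d ord0 != 0.
  by apply: contraNneq c0 => d0'; rewrite dE d0' rmorph0.
split; last by rewrite fE' coef_poly ltnSn d0 dE.
by rewrite fE' size_poly_eq // d0.
Qed.

Lemma D_has_degree k t f b : b != 0 -> Ixk I p x k t f -> D I p x k f (image_ideal b) ->
  has_degree_at b k f.
Proof.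
move=> b0 [If ft _] [_ [h /LCxE [fk ->] qh]].
split=> //; apply/eqP => fb; apply: qh.
by apply/(image_ideal_liftS x1 xp)/(point_ideal_homogE _ (expand_homog x1 xp k ft)).
Qed.

Lemma has_degree_not_in b k t f : f \is t.-homog -> ((expand f)`_k).@[b 0] != 0 ->
  ~ image_ideal b (liftS (expand f)`_k).
Proof.
move=> ft /eqP fb /(image_ideal_liftS x1 xp).
by move/(point_ideal_homogE _ (expand_homog x1 xp k ft)).
Qed.

(** The polynomial given by [exists_degree_at] is replaced by a homogeneous
    component whose leading coefficient does not vanish at b, and this component is
    multiplied by a linear form y of S with y(b) = 1 to get a total degree above k. *)
Lemma Zk_covered k q : Zk I p k q ->
  exists t f, [/\ Ixk I p x k t f, (k < t)%N & D I p x k f q].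
Proof.
move=> Zq; have [b b0 qE] := imageZ_image_ideal (proj1 Zq); have [_ _ IM] := idI.
rewrite qE in Zq *; have [w wk Iw] := Zk_restricts b0 Zq.
have [f If [fk fb]] := exists_degree_at wk Iw.
have [y y1 yb] := exists_linear_one b0.
have [d db] : exists d, (pihomog mdeg d (expand f)`_k).@[b 0] != 0.
  apply: NNPP => H; case/negP: fb.
  have [N cE] := pihomog_sum (expand f)`_k; rewrite (cE N (leqnn N)) rmorph_sum /=.
  rewrite big1 // => i _; apply/eqP/negPn/negP => ne; by apply: H; exists i.
pose fd := pihomog mdeg (d + k) f; pose f' := liftS y * fd.
have fdE : (expand fd)`_k = pihomog mdeg d (expand f)`_k.
  by rewrite (expand_pihomog x1 xp) leq_addl addnK.
have f'E i : (expand f')`_i = y * (expand fd)`_i.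
  by rewrite rmorphM /= (expand_liftS x1 xp) mul_polyC coefZ.
have f't : f' \is (1 + (d + k)).-homog.
  by apply: dhomogM; [apply: liftS_homog|apply: pihomogP].
have f'b : ((expand f')`_k).@[b 0] != 0.
  by rewrite f'E mevalM yb mul1r fdE.
have f'k : size (expand f') = k.+1.
  apply/anti_leq/andP; split.
    apply/leq_sizeP => j jk; rewrite f'E (expand_pihomog x1 xp).
    by rewrite [(expand f)`_j]nth_default ?fk // pihomog0 if_same mulr0.
  rewrite ltnNge; apply: contra f'b => le.
  by rewrite nth_default // meval0.
have LCf : LCx p x k f' (liftS (expand f')`_k) by apply/LCxE.
exists (1 + (d + k))%N, f'; split.
- split=> //; last by eexists; exact: LCf.
  by apply: IM; case: homI => _; apply.
- by rewrite add1n ltnS leq_addl.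
- split=> //; exists (liftS (expand f')`_k) => //.
  exact: has_degree_not_in f't f'b.
Qed.

(** The restriction of f is a multiple of w of the same degree. *)
Lemma has_degree_restricts b k f (w : {poly K}) :
  I f -> has_degree_at b k f -> size w = k.+1 ->
  restricts_to b w -> restricts_to b (dehom b f).
Proof.
move=> If [fk fb] wk Iw; apply: restricts_eqp (Iw).
have fbk : size (dehom b f) = k.+1.
  by rewrite dehomE size_map_poly_id0 // lead_coefE fk.
rewrite -dvdp_size_eqp ?wk ?fbk //.
by apply/Iw; exists f.
Qed.

Lemma dehom_eq0 b g : (forall i, ((expand g)`_i).@[b 0] = 0) -> dehom b g = 0.
Proof. by move=> g0; apply/polyP => i; rewrite dehomE coef_map /= g0 coef0. Qed.

Lemma coef_of_dehom b g i : (dehom b g)`_i = ((expand g)`_i).@[b 0].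
Proof. by rewrite dehomE coef_map. Qed.

(** If all elements of I of x-degree less than k vanish on the line, then so do all
    remainders of the division by f; thus f generates the restriction of I. *)
Lemma vanishing_restricts b k f : I f -> has_degree_at b k f ->
  (forall g, I g -> (size (expand g) <= k)%N -> dehom b g = 0) ->
  restricts_to b (dehom b f).
Proof.
move=> If [fk fb] van u; have [_ _ IM] := idI.
split=> [[g Ig <-]|/dvdpP[v ->]]; last first.
  have [h <-] := dehom_surj x1 xp b v.
  by exists (h * f); [apply: IM|rewrite dehomM].
have f0 : expand f != 0 by rewrite -size_poly_eq0 fk.
have [s [Q [r [Ir rf E]]]] := pseudo_division If Ig f0.
rewrite fk ltnS in rf; have r0 := van r Ir rf.
have c0 : (lead_coef (expand f)).@[b 0] ^+ s != 0 by rewrite expf_neq0 // lead_coefE fk.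
rewrite -(dvdpZr _ _ c0); apply/dvdpP; exists (map_poly (meval (b 0)) Q).
have := congr1 (map_poly (meval (b 0))) E.
by rewrite rmorphD !rmorphM map_polyZ /= rmorphXn /= -!dehomE r0 addr0.
Qed.

(** Where the leading coefficient of f does not vanish, the fiber has length at
    most k, and exactly k iff every element of I of x-degree less than k vanishes
    on the line, having a restriction divisible by a polynomial of degree k.  So
    inside the principal open set given by that coefficient, D f is closed. *)
Lemma D_equations k t f q : (0 < k)%N -> Ixk I p x k t f ->
  D I p x k f q <-> exists b, [/\ b != 0, q = image_ideal b, ((expand f)`_k).@[b 0] != 0 &
    forall g, I g -> (size (expand g) <= k)%N -> forall i, ((expand g)`_i).@[b 0] = 0].
Proof.
move=> k0 fI; have [If ft [h /LCxE[fk _]]] := fI; split.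
  move=> Dq; have [b b0 qE] := imageZ_image_ideal (proj1 (proj1 Dq)); rewrite qE in Dq *.
  have [_ fb] := D_has_degree b0 fI Dq; have [w wk Iw] := Zk_restricts b0 (proj1 Dq).
  exists b; split=> // g Ig gk i.
  have gs : (size (dehom b g) <= k)%N by rewrite dehomE (leq_trans (size_poly _ _)).
  have wg : w %| dehom b g by apply/Iw; exists g.
  rewrite -coef_of_dehom; suff -> : dehom b g = 0 by rewrite coef0.
  apply/eqP; apply: contraT => g0; have := dvdp_leq g0 wg.
  by rewrite wk ltnNge gs.
case=> b [b0 -> fb van]; have fdeg : has_degree_at b k f by [].
have Iw := vanishing_restricts If fdeg (fun g Ig gk => dehom_eq0 (van g Ig gk)).
split; last first.
  by exists (liftS (expand f)`_k); [apply/LCxE|apply: has_degree_not_in ft fb].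
apply: (restricts_Zk k0 b0 _ Iw).
by rewrite dehomE size_map_poly_id0 // lead_coefE fk.
Qed.

Lemma D_open k t f : Ixk I p x k t f -> zopen (weightS p) (Zk I p k) (D I p x k f).
Proof.
move=> [If ft _]; exists (LCx p x k f); split=> [g /LCxE[fk ->]|q].
  exists (t - k)%N; split; first by apply/(projSP x1 xp); eexists.
  exact/liftS_homog/expand_homog.
split=> [[Zq [h fh qh]]|[Zq H]].
  by split=> // H; apply/qh/H.
split=> //; apply: NNPP => H'; apply: H => h fh; apply: NNPP => qh.
by apply: H'; exists h.
Qed.


(** In the affine coordinate, the restriction of f generates the ideal of the fiber,
    and it is also the dehomogenization of the binary form of f; both conditions
    therefore say that it is, up to a scalar, the product of the (X - r_i)^lam_i for
    some distinct r_i. *)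
Lemma restriction_partition k t f q e (lam : 'I_e -> nat) (y : R) :
    Ixk I p x k t f -> D I p x k f q -> partition_of k lam ->
    projS p y -> y \is 1.-homog -> ~ q y ->
  exists a : 'I_k.+1 -> K, restriction p x t f q y a /\
    (Zlam I p lam q <-> Xlam_open lam a).
Proof.
move=> fI Dq lamP /(projSP x1 xp)[y0 ->] /(homog_liftS x1 xp) y01 qy.
have [b' b'0 qE'] := imageZ_image_ideal (proj1 (proj1 Dq)).
have y0b' : y0.@[b' 0] != 0.
  apply/eqP => H; apply: qy; rewrite qE'; apply/(image_ideal_liftS x1 xp).
  exact/(point_ideal_homogE _ y01).
(* choose the representative of the point with y(b) = 1, so that the coefficients of
   the binary form are the values at b of the coefficients of f *)
pose b := (y0.@[b' 0])^-1 *: b'.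
have b0 : b != 0 by rewrite scaler_eq0 invr_eq0 (negbTE y0b').
have qE : q = image_ideal b by rewrite qE' /b image_idealZ // invr_eq0.
have y0b : y0.@[b 0] = 1 by rewrite /b (meval_scale _ _ y01) expr1 mulVf.
clearbody b; rewrite {}qE {b' b'0 qE' y0b' qy} in Dq *.
have [fk fb] := D_has_degree b0 fI Dq; have [w wk Iw] := Zk_restricts b0 (proj1 Dq).
have [If ft _] := fI; have If_b := has_degree_restricts If (conj fk fb) wk Iw.
have kt : (k <= t)%N.
  rewrite leqNgt; apply/negP => lt.
  by move: fb; rewrite (expand_homog0 x1 xp ft lt) meval0 eqxx.
pose a (i : 'I_k.+1) := ((expand f)`_(k - i)).@[b 0].
have aE : dehom2 (binary_form a) = dehom b f.
  rewrite dehom2_binary_form (reindex_inj rev_ord_inj) /=.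
  rewrite -(coefK (dehom b f)) dehomE size_map_poly_id0 ?lead_coefE fk // poly_def.
  apply: eq_bigr => i _; rewrite coef_map /a /= subSS subKn // -ltnS //.
have a0 : a ord0 != 0 by rewrite /a subn0.
exists a; split.
  exists (fun i : 'I_k.+1 => liftS (expand f)`_(k - i)); first exact: expand_expansion.
  move=> i; exists ((expand f)`_(k - i) - a i *: y0 ^+ (t - k + i)).
    have ik : (i <= k)%N by rewrite -ltnS.
    have fi := expand_homog x1 xp (k - i) ft; rewrite subnBA // -addnBAC // in fi.
    have hom := dhomogB fi (dhomog_scale (a i) (dhomog_exp1 (t - k + i) y01)).
    apply/(point_ideal_homogE _ hom).
    by rewrite mevalB mevalZ rmorphXn /= y0b expr1n mulr1 subrr.
  by rewrite rmorphB /= liftSZ rmorphXn.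
have mp := ideal_avoids_center.
apply: iff_trans (iff_sym (Xlam_open_roots a0 lamP)); rewrite aE.
split=> [[_ [B fib]]|[r rI rE]].
  have [r [Br Ir]] := roots_of_fiber x1 xp b0 y01 y0b homI mp fib.
  exists r; last exact: restricts_uniq If_b Ir.
  have [_ BI _] := fib; have [lam0 _] := lamP.
  by move=> i j rij; apply: BI; rewrite !Br // rij.
split; first exact: (proj1 (proj1 Dq)).
exists (fun i => point_ideal (line_pt b (r i))).
apply: (fiber_of_roots x1 xp b0 y01 y0b homI mp rI).
exact: restricts_eqp rE If_b.
Qed.

End FibersOfDegree.

(** * Principal open subsets of the target are affine *)

Section PrincipalOpen.
Context {K : closedFieldType} {n : nat}.
Variables (p : 'rV[K]_n.+1) (x : {mpoly K[n.+1]}).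
Local Notation R := {mpoly K[n.+1]}.
Local Notation S0 := {mpoly K[n]}.
Hypotheses (x1 : x \is 1.-homog) (xp : ~ point_ideal p x).
Local Notation liftS := (liftS p x).
Local Notation image_ideal := (image_ideal p x).
Variables (d : nat) (h0 : S0) (J : pset K n).
Hypotheses (d_gt0 : (0 < d)%N) (h0d : h0 \is d.-homog).
Hypothesis homJ : forall c, J c -> exists s, c \is s.-homog.
Implicit Types (b : 'rV[K]_n) (c : S0) (z : 'rV[K]_#|{: 'X_{1..n < d.+1}}|).

(** Let h0 be a form of positive degree d in S.  The points where h0 does not
    vanish and all the forms of J do are embedded in an affine space by the
    functions m / h0, where m runs over the monomials of degree d (a Veronese
    embedding followed by the removal of the hyperplane section h0 = 0). *)
Definition in_locus b := [/\ b != 0, h0.@[b 0] != 0 & forall c, J c -> c.@[b 0] = 0].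
Definition locus (q : pset K n.+1) := exists2 b, in_locus b & q = image_ideal b.

Local Notation M := #|{: 'X_{1..n < d.+1}}|.
(** The coordinates are indexed by all monomials of degree at most d, which form a
    finite type; the ones of degree less than d take the value 0. *)
Definition mon (i : 'I_M) : 'X_{1..n} := bmnm (enum_val i).
Definition idx (m : 'X_{1..n}) : 'I_M := enum_rank (insubd (bm0 : 'X_{1..n < d.+1}) m).

Lemma mon_idx m : mdeg m = d -> mon (idx m) = m.
Proof. by move=> md; rewrite /mon /idx enum_rankK /= insubdK // -topredE /= md. Qed.

Lemma idx_mon i : idx (mon i) = i.
Proof. by rewrite /idx /mon valKd enum_valK. Qed.

Definition veronese i : S0 := if mdeg (mon i) == d then 'X_[mon i] else 0.
Definition veronese_pt b : 'rV[K]_M := \row_i ((veronese i).@[b 0] / h0.@[b 0]).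

Lemma veronese_homog i : veronese i \is d.-homog.
Proof. by rewrite /veronese; case: ifP => E; [rewrite dhomogX|exact: rpred0]. Qed.

Lemma veronese_pt_idx b m : mdeg m = d ->
  veronese_pt b 0 (idx m) = 'X_[m].@[b 0] / h0.@[b 0].
Proof. by move=> md; rewrite mxE /veronese mon_idx // md eqxx. Qed.

Lemma veronese_ptZ (l : K) b : l != 0 -> veronese_pt (l *: b) = veronese_pt b.
Proof.
move=> l0; apply/rowP => i; rewrite !mxE (meval_scale _ _ (veronese_homog i)).
by rewrite (meval_scale _ _ h0d) -mulf_div divff ?mul1r // expf_neq0.
Qed.

(** The monomials X_i^(d-1) X_j, for a fixed i, give back the homogeneous
    coordinates on the chart where X_i does not vanish. *)
Definition corner (i j : 'I_n) : 'X_{1..n} := (U_(i) *+ d.-1 + U_(j))%MM.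
Lemma mdeg_corner i j : mdeg (corner i j) = d.
Proof. by rewrite mdegD mdegMn !mdeg1 mul1n addn1 prednK. Qed.

Definition chart (i : 'I_n) : n.-tuple {mpoly K[M]} :=
  [tuple 'X_(idx (corner i j)) | j < n].
(** Homogeneous coordinates read off from the coordinates z of the affine space;
    at the image of b they are b multiplied by b_i^(d-1) / h0(b). *)
Definition chart_pt (z : 'rV[K]_M) (i : 'I_n) : 'rV[K]_n := \row_j z 0 (idx (corner i j)).

Lemma meval_corner b i j : 'X_[corner i j].@[b 0] = b 0 i ^+ d.-1 * b 0 j.
Proof. by rewrite mpolyXD mevalM -mpolyXn rmorphXn /= !mevalXU. Qed.

Lemma veronese_pt_corner b i j :
  veronese_pt b 0 (idx (corner i j)) = b 0 i ^+ d.-1 / h0.@[b 0] * b 0 j.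
Proof. by rewrite veronese_pt_idx ?mdeg_corner // meval_corner mulrAC. Qed.

Lemma chart_veronese_pt b i : chart_pt (veronese_pt b) i = (b 0 i ^+ d.-1 / h0.@[b 0]) *: b.
Proof. by apply/rowP => j; rewrite mxE veronese_pt_corner mxE. Qed.

Lemma meval_chart c z i : (c \mPo chart i).@[z 0] = c.@[chart_pt z i 0].
Proof.
rewrite comp_mpoly_meval; apply: meval_eq => j.
by rewrite tnth_mktuple mevalXU mxE.
Qed.

Lemma meval_chart_veronese_pt c s b i : c \is s.-homog ->
  (c \mPo chart i).@[veronese_pt b 0] = (b 0 i ^+ d.-1 / h0.@[b 0]) ^+ s * c.@[b 0].
Proof. by move=> cs; rewrite meval_chart chart_veronese_pt (meval_scale _ _ cs). Qed.

(** The vanishing ideal of the image; the image is the closed set that it defines. *)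
Definition veronese_relations : pset K M := fun F =>
  forall b, in_locus b -> F.@[veronese_pt b 0] = 0.

Lemma relation_eq z F G : (forall H, veronese_relations H -> H.@[z 0] = 0) ->
  (forall b, in_locus b -> F.@[veronese_pt b 0] = G.@[veronese_pt b 0]) -> F.@[z 0] = G.@[z 0].
Proof.
move=> zT E; apply/eqP; rewrite -subr_eq0 -mevalB; apply/eqP/zT => b /E.
by rewrite mevalB => ->; rewrite subrr.
Qed.

(** With z_m the coordinate of the monomial m, the relation (sum of h0_m z_m) = 1
    makes some z_m nonzero; the relation z_m^d = prod_i z_(X_i^d)^(m_i) then makes
    some c = z_(X_i^d) nonzero; let a be the homogeneous coordinates read off on
    the i-th chart.  The relation u(a) = z_u c^(d-1), for all monomials u of degree
    d, shows that z is the image of a, and the equations of J at a are relations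
    too. *)
Lemma veronese_relations_image z : (forall F, veronese_relations F -> F.@[z 0] = 0) ->
  exists2 b, in_locus b & z = veronese_pt b.
Proof.
move=> zT; have rel := relation_eq zT.
have zJ c i : J c -> c.@[chart_pt z i 0] = 0.
  move=> Jc; rewrite -meval_chart -[RHS](meval0 (z 0)); apply: rel => b [_ _ bJ].
  by have [s cs] := homJ Jc; rewrite (meval_chart_veronese_pt _ _ cs) (bJ _ Jc) mulr0 meval0.
have z0 i : mdeg (mon i) != d -> z 0 i = 0.
  move=> ne; rewrite -(mevalXU (z 0)) -[RHS](meval0 (z 0)); apply: rel => b _.
  by rewrite mevalXU mxE /veronese (negbTE ne) !meval0 mul0r.
have sum1 : \sum_(m <- msupp h0) h0@_m * z 0 (idx m) = 1.
  pose F : {mpoly K[M]} := \sum_(m <- msupp h0) h0@_m *: 'X_(idx m).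
  have FE v : F.@[v] = \sum_(m <- msupp h0) h0@_m * v (idx m).
    by rewrite /F rmorph_sum; apply: eq_bigr => m _; rewrite /= mevalZ mevalXU.
  rewrite -FE -[RHS](meval1 (z 0)); apply: rel => b [_ hb _].
  have hE : h0.@[b 0] = \sum_(m <- msupp h0) h0@_m * 'X_[m].@[b 0].
    rewrite (congr1 (meval (b 0)) (mpolyE h0)) rmorph_sum.
    by apply: eq_bigr => m _; rewrite /= mevalZ.
  rewrite FE meval1 -[RHS](divff hb) {1}hE mulr_suml.
  apply: eq_big_seq => m /(dhomog_mdeg h0d) md.
  by rewrite veronese_pt_idx // mulrA.
have [m md zm] : exists2 m, mdeg m = d & z 0 (idx m) != 0.
  apply: NNPP => H; move/eqP: sum1; rewrite eq_sym big_seq big1 ?oner_eq0 // => m mh.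
  suff -> : z 0 (idx m) = 0 by rewrite mulr0.
  apply/eqP/negPn/negP => zm; apply: H; exists m => //.
  exact: dhomog_mdeg h0d mh.
have meval_prod (F : 'I_n -> 'I_M) (e : 'I_n -> nat) (v : 'rV[K]_M) :
    (\prod_i 'X_(F i) ^+ e i : {mpoly K[M]}).@[v 0] = \prod_i v 0 (F i) ^+ e i.
  by rewrite rmorph_prod; apply: eq_bigr => i _; rewrite /= rmorphXn /= mevalXU.
have prod_corner b (e : 'I_n -> nat) (l : 'I_n -> K) :
    \prod_i (l i * b 0 i) ^+ e i = \prod_i l i ^+ e i * \prod_i b 0 i ^+ e i.
  by rewrite -big_split; apply: eq_bigr => i _; rewrite /= exprMn.
have sum_md u : mdeg u = d -> (\sum_i u i)%N = d by rewrite mdegE.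
have [i mi zi] : exists2 i, (0 < m i)%N & z 0 (idx (corner i i)) != 0.
  have E : z 0 (idx m) ^+ d = \prod_i z 0 (idx (corner i i)) ^+ m i.
    rewrite -(mevalXU (z 0)) -rmorphXn -(meval_prod (fun i => idx (corner i i))).
    apply: rel => b [_ hb _]; rewrite meval_prod rmorphXn /= mevalXU veronese_pt_idx //.
    rewrite mevalX expr_div_n -prodrXl.
    under [RHS]eq_bigr do rewrite veronese_pt_corner mulrAC -exprSr prednK // expr_div_n.
    rewrite big_split /= prodfV prodrXr sum_md //; congr (_ / _).
    by apply: eq_bigr => i _; rewrite -!exprM mulnC.
  have : \prod_i z 0 (idx (corner i i)) ^+ m i != 0 by rewrite -E expf_neq0.
  move/prodf_neq0 => nz; apply: NNPP => H.
  have : (\sum_i m i)%N != 0%N by rewrite sum_md // -lt0n.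
  rewrite big1 ?eqxx // => i _; apply/eqP; rewrite -leqn0 leqNgt; apply/negP => mi.
  by apply: H; exists i => //; have := nz i isT; rewrite expf_eq0 mi.
set c := z 0 _ in zi.
have avm u : mdeg u = d -> 'X_[u].@[chart_pt z i 0] = z 0 (idx u) * c ^+ d.-1.
  move=> ud; rewrite mevalX; under eq_bigr do rewrite mxE.
  rewrite -(meval_prod (fun j => idx (corner i j))) /c -!(mevalXU (z 0)) -rmorphXn -mevalM.
  apply: rel => b [_ hb _]; rewrite meval_prod mevalM rmorphXn /= !mevalXU veronese_pt_idx //.
  under eq_bigr do rewrite veronese_pt_corner.
  rewrite prod_corner prodrXr sum_md // -mevalX veronese_pt_corner.
  set l := b 0 i ^+ d.-1 / h0.@[b 0]; set B := 'X_[u].@[b 0].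
  have lE : b 0 i ^+ d.-1 = l * h0.@[b 0] by rewrite mulfVK.
  have -> : l ^+ d = l * l ^+ d.-1 by rewrite -exprS prednK.
  rewrite [(l * _) ^+ _]exprMn lE [RHS]mulrCA [B / _ * _]mulrACA mulVf // mulr1.
  by rewrite [l * _]mulrC -mulrA [l * B]mulrC.
have cE : chart_pt z i 0 i = c by rewrite mxE.
have hE : h0.@[chart_pt z i 0] = c ^+ d.-1.
  rewrite (congr1 (meval (chart_pt z i 0)) (mpolyE h0)) rmorph_sum /=.
  rewrite -[RHS]mul1r -sum1 mulr_suml; apply: eq_big_seq => m' /(dhomog_mdeg h0d) m'd.
  by rewrite mevalZ avm // mulrA.
have cd0 : c ^+ d.-1 != 0 by rewrite expf_neq0.
exists (chart_pt z i).
  split; [|by rewrite hE|by move=> c' /zJ].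
  by apply: contraNneq zi => a0; rewrite -cE a0 mxE.
apply/rowP => k; have [kd|kd] := eqVneq (mdeg (mon k)) d; last first.
  by rewrite z0 // mxE /veronese (negbTE kd) meval0 mul0r.
by rewrite -(idx_mon k) veronese_pt_idx // avm // hE mulfK.
Qed.

Lemma veronese_pt_eq b b' : in_locus b -> in_locus b' -> veronese_pt b = veronese_pt b' ->
  exists2 l : K, l != 0 & b' = l *: b.
Proof.
move=> [b0 hb _] [b'0 hb' _] E; have /rV0Pn[i bi] := b0.
have := congr1 (fun z => chart_pt z i) E; rewrite !chart_veronese_pt.
set l := _ / h0.@[b 0]; set l' := _ / _ => E'.
have l0 : l != 0 by rewrite mulf_neq0 ?invr_eq0 ?expf_neq0.
have l'0 : l' != 0.
  apply: contraNneq b0 => l'0; move/eqP: E'.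
  by rewrite l'0 scale0r scaler_eq0 (negbTE l0).
exists (l'^-1 * l); first by rewrite mulf_neq0 ?invr_eq0.
by rewrite -scalerA E' scalerA mulVf // scale1r.
Qed.

(** h0^e times the pullback of F, a form on the source that has the same zeros
    where h0 does not vanish. *)
Definition homogenize e (F : {mpoly K[M]}) : S0 :=
  \sum_(m <- msupp F) F@_m *: (\prod_i veronese i ^+ m i * h0 ^+ (e - mdeg m)).

Lemma homogenize_homog e F : (msize F <= e.+1)%N -> homogenize e F \is (d * e).-homog.
Proof.
move=> Fe; rewrite /homogenize big_seq; apply: dhomog_sum => m mF.
have me : (mdeg m <= e)%N by rewrite -ltnS (leq_trans (msize_mdeg_lt mF)).
have -> : (d * e = (\sum_i d * m i) + d * (e - mdeg m))%N.
  by rewrite -big_distrr /= -mdegE -mulnDr subnKC.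
apply: dhomog_scale.
by apply: dhomogM; [apply: dhomog_prodX => i; apply: veronese_homog|exact: (dhomog_exp _ h0d)].
Qed.

Lemma meval_homogenize e F b : (msize F <= e.+1)%N -> h0.@[b 0] != 0 ->
  (homogenize e F).@[b 0] = h0.@[b 0] ^+ e * F.@[veronese_pt b 0].
Proof.
move=> Fe hb; rewrite /homogenize rmorph_sum mevalE mulr_sumr.
apply: eq_big_seq => m mF; rewrite /= mevalZ mevalM rmorph_prod rmorphXn /=.
have me : (mdeg m <= e)%N by rewrite -ltnS (leq_trans (msize_mdeg_lt mF)).
rewrite [RHS]mulrCA; congr (_ * _).
rewrite -{2}(subnK me) exprD -mulrA mulrC; congr (_ * _).
rewrite mdegE -prodrXr -big_split; apply: eq_bigr => i _.
by rewrite rmorphXn /= mxE -exprMn mulrC mulfVK.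
Qed.

Lemma image_ideal_homogE s c b : c \is s.-homog -> image_ideal b (liftS c) <-> c.@[b 0] = 0.
Proof.
move=> cs; split=> [/(image_ideal_liftS x1 xp)|cb]; first by move/(point_ideal_homogE _ cs).
by apply/(image_ideal_liftS x1 xp)/(point_ideal_homogE _ cs).
Qed.

(** Defined on ideals by quantifying over the coordinates of the point, which avoids
    a choice of representatives; the value does not depend on them. *)
Definition affine_chart (q : pset K n.+1) : pset K M := fun F =>
  exists b, [/\ in_locus b, q = image_ideal b & F.@[veronese_pt b 0] = 0].

Lemma affine_chartE b : in_locus b ->
  affine_chart (image_ideal b) = (fun F => F.@[veronese_pt b 0] = 0).
Proof.
move=> Wb; apply: pred_ext => F; split=> [[b' [Wb' E]]|Fb]; last by exists b.
case: (Wb) (Wb') => [b0 _ _] [b'0 _ _].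
have [l l0 ->] := image_ideal_eq x1 xp b0 b'0 E.
by rewrite veronese_ptZ.
Qed.

(** Topology and regular functions are compared through functions.  A polynomial
    on the affine space pulls back to a form by [homogenize]; a form c on the source
    is pushed forward by substituting the coordinates of the i-th chart, which
    multiplies its values by the power (b_i^(d-1) / h0(b))^s, with s the degree of c.
    This factor is nonzero where X_i is, and it is the same for a numerator and a
    denominator of the same degree. *)
Theorem principal_affine : affine (weightS p) locus.
Proof.
exists M, veronese_relations, affine_chart => pre.
have chartP b F : in_locus b -> affine_chart (image_ideal b) F <-> F.@[veronese_pt b 0] = 0.
  by move=> Wb; rewrite affine_chartE.
have chart_in q : locus q -> affine_closed veronese_relations (affine_chart q).
  by case=> b Wb ->; rewrite affine_chartE //; exists (veronese_pt b) => // F; apply.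
have chart_onto P : affine_closed veronese_relations P -> exists2 b, in_locus b &
    P = affine_chart (image_ideal b).
  by case=> z zT ->; have [b Wb ->] := veronese_relations_image zT; exists b;
    rewrite ?affine_chartE.
split.
- exact: chart_in.
- move=> _ _ [b Wb ->] [b' Wb' ->]; rewrite !affine_chartE // => E.
  have zE : veronese_pt b = veronese_pt b'.
    apply/rowP => i; have := congr1 (fun P => P ('X_i - (veronese_pt b' 0 i)%:MP)) E.
    rewrite /= !mevalB !mevalXU !mevalC subrr => H.
    by apply/eqP; rewrite -subr_eq0; apply/eqP; rewrite H.
  by have [l l0 ->] := veronese_pt_eq Wb Wb' zE; rewrite image_idealZ.
- by move=> P /chart_onto[b Wb ->]; exists (image_ideal b) => //; exists b.
- move=> U UW; split=> [[T [_ TU]]|[T [TA TU]]].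
    exists (fun g => exists2 F, T F & g = liftS (homogenize (msize F) F)).
    split=> [_ [F _ ->]|q].
      exists (d * msize F)%N; split; first by apply/(projSP x1 xp); eexists.
      by apply/liftS_homog/homogenize_homog.
    split=> [[Wq /TU[_ H]]|[Wq H]]; (split; first exact: Wq).
      move=> H'; case: Wq H' H => b Wb -> H'; apply=> F TF; apply/(chartP _ _ Wb).
      case: (Wb) => _ hb _; have := H' _ (ex_intro2 _ _ F TF erefl).
      have Fh := homogenize_homog (leqnSn (msize F)).
      move/(image_ideal_homogE _ Fh)/eqP; rewrite meval_homogenize // mulf_eq0 expf_eq0.
      by rewrite (negbTE hb) andbF => /eqP.
    apply/TU; split; first exact: chart_in.
    move=> H'; apply: H => _ [F TF ->]; case: Wq H' => b Wb -> H'.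
    apply/(image_ideal_homogE _ (homogenize_homog (leqnSn (msize F)))).
    case: (Wb) => _ hb _; rewrite meval_homogenize //.
    by have /(chartP _ _ Wb) -> := H' F TF; rewrite mulr0.
  exists (fun F => exists c i, T (liftS c) /\ F = c \mPo chart i).
  split=> [F _|P]; first by exists 0%N.
  split=> [UP|[WP H]].
    have WP := UW _ UP; split=> //.
    have [b Wb PE] := chart_onto _ WP; rewrite PE in UP *.
    have /TU[_ H] : pre U (image_ideal b) by split=> //; exists b.
    move=> H'; apply: H => g Tg; have [s [/(projSP x1 xp)[c gE] gs]] := TA _ Tg.
    rewrite gE in Tg gs *; have cs := homog_liftS x1 xp gs.
    apply/(image_ideal_homogE _ cs); case: (Wb) => /rV0Pn[i bi] hb _.
    have /(chartP _ _ Wb) : affine_chart (image_ideal b) (c \mPo chart i).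
      by apply: H'; exists c, i.
    rewrite (meval_chart_veronese_pt _ _ cs) => /eqP; rewrite mulf_eq0 expf_eq0 mulf_eq0.
    by rewrite expf_eq0 (negbTE bi) invr_eq0 (negbTE hb) !andbF => /eqP.
  have [b Wb PE] := chart_onto _ WP; rewrite PE in H *.
  suff [] : pre U (image_ideal b) by [].
  apply/TU; split; first by exists b.
  move=> H'; apply: H => _ [c [i [Tc ->]]]; apply/(chartP _ _ Wb).
  have [s [_ cs]] := TA _ Tc; have {}cs := homog_liftS x1 xp cs.
  rewrite (meval_chart_veronese_pt _ _ cs).
  by have /(image_ideal_homogE _ cs) -> := H' _ Tc; rewrite mulr0.
- move=> U phi [T [_ TU]]; have UW P : U P -> affine_closed veronese_relations P.
    by case/TU.
  split=> reg.
    move=> q [[b Wb ->] Uq]; have [e [F [G [_ _ nG FG]]]] := reg _ Uq.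
    pose E := maxn (msize F) (msize G).
    have FE : (msize F <= E.+1)%N by rewrite leqW // leq_maxl.
    have GE : (msize G <= E.+1)%N by rewrite leqW // leq_maxr.
    have Fh := homogenize_homog FE; have Gh := homogenize_homog GE.
    exists (d * E)%N, (liftS (homogenize E F)), (liftS (homogenize E G)); split.
    + by split; [apply/(projSP x1 xp); eexists|apply: liftS_homog].
    + by split; [apply/(projSP x1 xp); eexists|apply: liftS_homog].
    + move/(image_ideal_homogE _ Gh)/eqP; case: (Wb) => _ hb _.
      rewrite meval_homogenize // mulf_eq0 expf_eq0 (negbTE hb) andbF => /eqP Gb.
      by apply/nG/(chartP _ _ Wb).
    + move=> _ [[b' Wb' ->] Uq'] nG'; case: (Wb') => _ hb' _.
      have nGb' : ~ affine_chart (image_ideal b') G.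
        move/(chartP _ _ Wb') => Gb'; apply/nG'/(image_ideal_homogE _ Gh).
        by rewrite meval_homogenize // Gb' mulr0.
      have /(chartP _ _ Wb') := FG _ Uq' nGb'; rewrite mevalB mevalZ => FGb.
      rewrite -liftSZ -rmorphB; apply/(image_ideal_homogE _ (dhomogB Fh (dhomog_scale _ Gh))).
      by rewrite mevalB mevalZ !meval_homogenize // mulrCA -mulrBr FGb mulr0.
  move=> P UP; have [b Wb PE] := chart_onto _ (UW _ UP); rewrite PE in UP *.
  have Uq : pre U (image_ideal b) by split=> //; exists b.
  have [s [_ [_ [[/(projSP x1 xp)[c ->] cs] [/(projSP x1 xp)[c' ->] c's] nc' cc']]]] :=
    reg _ Uq.
  have {}cs := homog_liftS x1 xp cs; have {}c's := homog_liftS x1 xp c's.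
  case: (Wb) => /rV0Pn[i bi] hb _.
  exists 0%N, (c \mPo chart i), (c' \mPo chart i); split=> //.
    move/(chartP _ _ Wb)/eqP; rewrite (meval_chart_veronese_pt _ _ c's).
    rewrite mulf_eq0 expf_eq0 mulf_eq0.
    rewrite expf_eq0 (negbTE bi) invr_eq0 (negbTE hb) !andbF => /eqP c'b.
    by apply/nc'/(image_ideal_homogE _ c's).
  move=> P' UP'; have [b' Wb' PE'] := chart_onto _ (UW _ UP'); rewrite PE' in UP' *.
  move=> nc; have Uq' : pre U (image_ideal b') by split=> //; exists b'.
  have nq : ~ image_ideal b' (liftS c').
    move/(image_ideal_homogE _ c's) => c'b; apply/nc/(chartP _ _ Wb').
    by rewrite (meval_chart_veronese_pt _ _ c's) c'b mulr0.
  have := cc' _ Uq' nq; rewrite -liftSZ -rmorphB.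
  move/(image_ideal_homogE _ (dhomogB cs (dhomog_scale _ c's))); rewrite mevalB mevalZ => E.
  apply/(chartP _ _ Wb'); rewrite mevalB mevalZ (meval_chart_veronese_pt _ _ cs).
  by rewrite (meval_chart_veronese_pt _ _ c's) mulrCA -mulrBr E mulr0.
Qed.

End PrincipalOpen.

(** * The affine covering *)

(** The form sum_j t^j X_j does not vanish at any of the points, for t outside the
    roots of a nonzero polynomial. *)
Lemma avoiding_linear_form (K : closedFieldType) n s (b : 'I_s -> 'rV[K]_n) :
    (forall i, b i != 0) ->
  exists2 h : {mpoly K[n]}, h \is 1.-homog & forall i, h.@[b i 0] != 0.
Proof.
move=> b0; pose P i : {poly K} := \sum_(j < n) b i 0 j *: 'X^j.
have Pj i (j : 'I_n) : (P i)`_j = b i 0 j.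
  rewrite coef_sum (bigD1 j) //= coefZ coefXn eqxx mulr1 big1 ?addr0 // => j' ne.
  rewrite coefZ coefXn; case: eqP => [E|]; rewrite ?mulr0 //.
  by case/eqP: ne; apply: val_inj.
have P0 i : P i != 0.
  have /rV0Pn[j bj] := b0 i; apply: contraNneq bj => Pi0.
  by rewrite -Pj Pi0 coef0.
have : \prod_i P i != 0 by apply/prodf_neq0 => i _.
case/closed_nonrootP => t; rewrite rootE horner_prod => /prodf_neq0 Pt.
exists (\sum_(j < n) t ^+ j *: 'X_j).
  by apply: dhomog_sum => j _; apply: dhomog_scale; rewrite dhomogX /= mdeg1.
move=> i; have := Pt i isT; rewrite horner_sum rmorph_sum /=; congr (_ != _).
by apply: eq_bigr => j _; rewrite hornerZ hornerXn mevalZ mevalXU mulrC.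
Qed.

Section AffineCovering.
Context {K : closedFieldType} {n : nat}.
Variables (p : 'rV[K]_n.+1) (x : {mpoly K[n.+1]}) (I : pset K n.+1).
Local Notation R := {mpoly K[n.+1]}.
Local Notation S0 := {mpoly K[n]}.
Implicit Types (g h f : R) (b : 'rV[K]_n) (q : pset K n.+1).
Local Notation expand := (expand p x).
Local Notation image_ideal := (image_ideal p x).
Hypotheses (homI : homogeneous_ideal I).
Hypotheses (p_neq0 : p != 0) (p_notin_Z : ~ scheme_pt I (point_ideal p)).
Hypotheses (x1 : x \is 1.-homog) (xp : ~ point_ideal p x).

(** A finite set is closed, being separated from any other point by a product of
    linear forms, and it lies in the principal open set of a linear form. *)
Lemma finite_affine (V : pset K n.+1 -> Prop) : (0 < n)%N ->
    (forall q, V q -> exists2 b, b != 0 & q = image_ideal b) -> finite_pts V ->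
  affine (weightS p) V.
Proof.
move=> n0 Vpt [s [P VP]].
have one0 : const_mx 1 != 0 :> 'rV[K]_n.
  by apply/rV0Pn; exists (Ordinal n0); rewrite mxE oner_eq0.
have /fin_all_exists[b bP] i : exists b, b != 0 /\ (V (P i) -> P i = image_ideal b).
  (* members of the list outside V are harmless: give them any nonzero coordinates *)
  have [Vi|nVi] := classic (V (P i)); last by exists (const_mx 1).
  by have [b b0 E] := Vpt _ Vi; exists b.
have b0 i : b i != 0 by case: (bP i).
have [h h1 hb] := avoiding_linear_form b0.
pose J : pset K n := fun c =>
  (exists d, c \is d.-homog) /\ forall b', b' != 0 -> V (image_ideal b') -> c.@[b' 0] = 0.
suff -> : V = locus p x h J by apply: (principal_affine x1 xp _ h1) => // c [].
apply: pred_ext => q; split=> [Vq|[b' [b'0 hb' b'J] ->]].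
  have [i qE] := VP _ Vq; have [_ Pb] := bP i.
  rewrite qE in Vq *; have Vb := Vq; rewrite Pb // in Vb *.
  by exists (b i) => //; split=> // c [_]; apply.
apply: NNPP => nV.
have /fin_all_exists[c cP] i : exists c : S0, [/\ exists d, c \is d.-homog,
    V (P i) -> c.@[b i 0] = 0 & c.@[b' 0] != 0].
  have [Vi|nVi] := classic (V (P i)); last first.
    by exists 1; split=> //; [exists 0%N; apply: dhomog1|rewrite meval1 oner_eq0].
  apply: NNPP => H; apply: nV; have [_ Pb] := bP i.
  have [g g1 gb|l E] := @point_ideal_sub _ _ (b i) b' (b0 i).
    apply: NNPP => gb'; apply: H; exists g; split; first by exists 1%N.
      by move=> _; apply/(point_ideal_homogE _ g1).
    by apply/eqP => gb0; apply/gb'/(point_ideal_homogE _ g1).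
  rewrite E image_idealZ -?Pb //; apply: contraNneq b'0 => l0.
  by rewrite E l0 scale0r.
have /fin_all_exists[d cd] i : exists d, c i \is d.-homog by case: (cP i).
suff /b'J/eqP : J (\prod_i c i).
  by rewrite rmorph_prod; apply/negP/prodf_neq0 => i _; case: (cP i).
split.
  exists (\sum_i d i * 1)%N; under eq_bigr do rewrite -[c _]expr1.
  exact: dhomog_prodX.
move=> u u0 Vu; have [i uE] := VP _ Vu; have [_ Pb] := bP i; have [_ ci _] := cP i.
rewrite uE in Vu.
have [l _ ->] := image_ideal_eq x1 xp (b0 i) u0 (etrans (esym (Pb Vu)) (esym uE)).
by rewrite rmorph_prod (bigD1 i) //= (meval_scale _ _ (cd i)) ci // mulr0 mul0r.
Qed.

(** By [D_equations], D f is closed in the principal open set of its leading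
    coefficient, a form of positive degree t - k. *)
Lemma D_affine k t f : (0 < k)%N -> (k < t)%N -> Ixk I p x k t f ->
  affine (weightS p) (D I p x k f).
Proof.
move=> k0 kt fI; have [If ft _] := fI; have [_ homIg] := homI.
pose J : pset K n := fun c => exists g d i,
  [/\ I g, g \is d.-homog, (size (expand g) <= k)%N & c = (expand g)`_i].
suff -> : D I p x k f = locus p x (expand f)`_k J.
  apply: (principal_affine x1 xp _ (expand_homog x1 xp k ft)); first by rewrite subn_gt0.
  by move=> _ [g [d [i [_ gd _ ->]]]]; exists (d - i)%N; apply: expand_homog.
apply: pred_ext => q.
have eqn u := D_equations homI p_neq0 p_notin_Z x1 xp u k0 fI.
split=> [/eqn[b [b0 -> fb van]]|[b [b0 fb bJ] ->]].
  by exists b => //; split=> // _ [g [d [i [Ig _ gk ->]]]]; apply: van.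
apply/eqn; exists b; split=> // g Ig gk i.
have [N cE] := pihomog_sum (expand g)`_i.
rewrite (cE N (leqnn N)) rmorph_sum big1 // => e _ /=.
have -> : pihomog mdeg e (expand g)`_i = (expand (pihomog mdeg (e + i) g))`_i.
  by rewrite (expand_pihomog x1 xp) leq_addl addnK.
apply: bJ; exists (pihomog mdeg (e + i) g), (e + i)%N, i; split=> //.
- exact: homIg.
- exact: pihomogP.
apply/leq_sizeP => j kj; rewrite (expand_pihomog x1 xp).
by rewrite [(expand g)`_j]nth_default ?(leq_trans gk) // pihomog0 if_same.
Qed.

Lemma D_affine_finite k t f : (0 < n)%N -> Ixk I p x k t f -> finite_pts (Zk I p k) ->
  affine (weightS p) (D I p x k f).
Proof.
move=> n0 fI [s [P ZP]]; apply: finite_affine => // [q [[imq _] _]|].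
  exact: (imageZ_image_ideal p_neq0 p_notin_Z x1 xp imq).
by exists s, P => q [/ZP].
Qed.

End AffineCovering.

Theorem proposition2p2 (K : closedFieldType) (charK0 : [pchar K] =i pred0)
    (n : nat) (n_gt0 : (0 < n)%N)
    (I : {mpoly K[n.+1]} -> Prop)
    (homI : homogeneous_ideal I) (satI : saturated I)
    (p : 'rV[K]_n.+1) (p_neq0 : p != 0)
    (p_notin_Z : ~ scheme_pt I (point_ideal p))
    (x : {mpoly K[n.+1]}) (x_lin : x \is 1.-homog) (xp : ~ point_ideal p x)
    (k : nat) (k_gt0 : (0 < k)%N) :
  [/\ forall t f, Ixk I p x k t f ->
        zopen (weightS p) (Zk I p k) (D I p x k f),
      forall t f, Ixk I p x k t f -> (k < t)%N \/ finite_pts (Zk I p k) ->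
        affine (weightS p) (D I p x k f),
      forall q, Zk I p k q <->
        exists t f, [/\ Ixk I p x k t f, (k < t)%N & D I p x k f q]
    & forall t f q (e : nat) (lam : 'I_e -> nat) (y : {mpoly K[n.+1]}),
        Ixk I p x k t f -> D I p x k f q -> partition_of k lam ->
        projS p y -> y \is 1.-homog -> ~ q y ->
        exists a : 'I_k.+1 -> K, restriction p x t f q y a /\
          (Zlam I p lam q <-> Xlam_open lam a)].
Proof.
split.
- by move=> t f; apply: D_open.
- move=> t f fI [kt|fin]; first exact: D_affine kt fI.
  exact: D_affine_finite fI fin.
- move=> q; split; first exact: Zk_covered.
  by case=> t [f [_ _ []]].
- by move=> t f q e lam y; apply: restriction_partition.
Qed.
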